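(* Let $n \geq 2$ be an integer and $s>0$. Suppose there is a constant $C_s$ such that for every Schwartz function $f$ on $\mathbb{R}^n$, \[ \Big\| \sup_{0<t<1} |(e^{it\Delta} f)(x)| \Big\|_{L^1(B_n(0,1), dx)} \leq C_s \|f\|_{H^s(\mathbb{R}^n)}. \] Then $s \geq \frac{n}{2(n+1)}$.
   Context: Fourier transform convention: $\hat{f}(\xi) = \int_{\mathbb{R}^n} f(x) e^{-i x\cdot \xi}\,dx$. For a Schwartz function $f$ on $\mathbb{R}^n$ and $t \in \mathbb{R}$, \[ (e^{it\Delta} f)(x) = \frac{1}{(2\pi)^n} \int_{\mathbb{R}^n} \hat{f}(\xi) e^{i(\xi\cdot x + |\xi|^2 t)}\,d\xi. \] The Sobolev norm is $\|f\|_{H^s(\mathbb{R}^n)}^2 = (2\pi)^{-n} \int_{\mathbb{R}^n} (1+|\xi|^2)^{s} |\hat{f}(\xi)|^2\,d\xi$. $B_n(0,1)$ denotes the Euclidean unit ball in $\mathbb{R}^n$ centered at the origin. *)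

(* Defs.v *)
From HB Require Import structures.
From mathcomp Require Import all_boot all_order all_algebra.
From mathcomp Require Import all_classical all_reals all_analysis.
From mathcomp Require Import complex.
Set Implicit Arguments. Unset Strict Implicit. Unset Printing Implicit Defensive.
Import Order.TTheory GRing.Theory Num.Theory.
Import numFieldNormedType.Exports.
Local Open Scope classical_set_scope.
Local Open Scope ring_scope.

Section Defs.
Variable R : realType.

Definition rcons_pt (k : nat) (x : R) (v : 'rV[R]_k) : 'rV[R]_k.+1 :=
  row_mx (\row_(j < 1) x) v.

Definition dotR (n : nat) (x y : 'rV[R]_n) : R := \sum_(i < n) x 0 i * y 0 i.
Definition normsq (n : nat) (x : 'rV[R]_n) : R := dotR x x.

(* Lebesgue integral over R^n of a nonnegative extended-real function,
   as an iterated integral of 1-dimensional Lebesgue integrals (Tonelli). *)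
Fixpoint int_Rn_e (n : nat) : ('rV[R]_n -> \bar R) -> \bar R :=
  match n with
  | 0 => fun f => f 0
  | k.+1 => fun f =>
      (\int[@lebesgue_measure R]_(x in [set: R]) int_Rn_e (fun v => f (rcons_pt x v)))%E
  end.

(* Lebesgue integral over R^n of an integrable real function, as an iterated
   integral of 1-dimensional (real-valued) Lebesgue integrals (Fubini). *)
Fixpoint int_Rn (n : nat) : ('rV[R]_n -> R) -> R :=
  match n with
  | 0 => fun f => f 0
  | k.+1 => fun f =>
      Rintegral (@lebesgue_measure R) [set: R] (fun x => int_Rn (fun v => f (rcons_pt x v)))
  end.

Definition cint_Rn (n : nat) (f : 'rV[R]_n -> R[i]) : R[i] :=
  Complex (int_Rn (fun x => complex.Re (f x))) (int_Rn (fun x => complex.Im (f x))).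

Definition cabs (z : R[i]) : R := Num.sqrt (complex.Re z ^+ 2 + complex.Im z ^+ 2).

Definition expi (th : R) : R[i] := Complex (cos th) (sin th).

Definition pderiv (n : nat) (al : seq 'I_n) (g : 'rV[R]_n -> R) : 'rV[R]_n -> R :=
  foldr (fun i h => fun x => 'D_(delta_mx 0 i) h x) g al.

Definition schwartz_real (n : nat) (g : 'rV[R]_n -> R) : Prop :=
  (forall (al : seq 'I_n) (x : 'rV[R]_n), differentiable (pderiv al g) x) /\
  (forall (al : seq 'I_n) (beta : 'I_n -> nat), exists C : R,
     forall x : 'rV[R]_n, `|(\prod_(i < n) x 0 i ^+ beta i) * pderiv al g x| <= C).

Definition schwartz (n : nat) (f : 'rV[R]_n -> R[i]) : Prop :=
  schwartz_real (fun x => complex.Re (f x)) /\ schwartz_real (fun x => complex.Im (f x)).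

Definition fourier (n : nat) (f : 'rV[R]_n -> R[i]) (xi : 'rV[R]_n) : R[i] :=
  cint_Rn (fun x => f x * expi (- dotR x xi)).

Definition schrodinger (n : nat) (t : R) (f : 'rV[R]_n -> R[i]) (x : 'rV[R]_n) : R[i] :=
  (((2 * pi) ^- n)%:C)%C *
  cint_Rn (fun xi => fourier f xi * expi (dotR xi x + normsq xi * t)).

(* ||f||_{H^s}^2 = (2 pi)^{-n} int (1+|xi|^2)^s |hat f(xi)|^2 dxi  (finite for
   Schwartz f) *)
Definition sobolev_normsq (n : nat) (s : R) (f : 'rV[R]_n -> R[i]) : \bar R :=
  (((2 * pi) ^- n)%:E *
   int_Rn_e (fun xi => ((1 + normsq xi) `^ s * cabs (fourier f xi) ^+ 2)%:E))%E.

Definition sobolev_norm (n : nat) (s : R) (f : 'rV[R]_n -> R[i]) : R :=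
  Num.sqrt (fine (sobolev_normsq s f)).

Definition max_schrodinger (n : nat) (f : 'rV[R]_n -> R[i]) (x : 'rV[R]_n) : \bar R :=
  ereal_sup [set (cabs (schrodinger t f x))%:E | t in `]0, 1[%classic].

Definition L1_unit_ball (n : nat) (F : 'rV[R]_n -> \bar R) : \bar R :=
  int_Rn_e (fun x => if `[< normsq x < 1 >] then F x else 0%E).

End Defs.

(* Main.v *)
(** A variant of Bourgain's counterexample with full constructive interference
    instead of Gauss sums, in the spirit of Luca and Rogers.  Write [n = d + 1].
    The datum is a product of one-dimensional waves.  In the first variable it
    is a Gaussian of width [P^(-1/2)] at frequency [-P], [P = N^(2n+2)]; it sits
    at [x_0] only for times [t] in a window of length about [P^(-3/2)] around
    [x_0 / (2P)].  In each other variable it is a unit Gaussian times the sum of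
    [N] exponentials with frequencies [a_i + L k], where [L] is a constant times
    [N^(2n+1)].  For [t = 2 pi m / L^2] the quadratic phases of that sum vanish
    modulo [2 pi], and its terms are aligned as soon as
    [L x_i / (2 pi) + m / Q^i] is close to an integer, for the choice
    [a_i = L / (2 Q^i)] with [Q] a constant times [N].  The fractional parts of
    [m / Q, .., m / Q^d] have leading base-[Q] digits equal to the [d] digits
    of [m], so every window of [Q^d] consecutive integers contains an [m] that
    aligns all the coordinates at once, and the time window is long enough for
    that.  Hence the maximal function is at least of order [N^d] on a fixed box,
    while the squared Sobolev norm is of order [P^(2s) N^d / P^(1/2)]; letting
    [N] tend to infinity gives [s >= n / (2 (n + 1))]. *)

Require Import Defs.
From HB Require Import structures.
From mathcomp Require Import all_boot all_order all_algebra.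
From mathcomp Require Import all_classical all_reals all_analysis.
From mathcomp Require Import measurable_realfun.
From mathcomp Require Import complex.
From mathcomp Require Import ring lra zify.
Set Implicit Arguments. Unset Strict Implicit. Unset Printing Implicit Defensive.
Import Order.TTheory GRing.Theory Num.Theory.
Import numFieldNormedType.Exports.
Local Open Scope classical_set_scope.
Local Open Scope ring_scope.

(** * Gaussian integrals *)

Lemma cos_ge1B (R : realType) (u : R) : 1 - `|u| <= cos u.
Proof.
wlog u0 : u / 0 <= u.
  move=> H; have [/H//|/ltW u0] := leP 0 u.
  by rewrite -cosN -normrN; apply: H; rewrite oppr_ge0.
rewrite ger0_norm//.
have [c _] : exists2 c, c \in `[0, u] & cos u - cos 0 = - sin c * (u - 0).
  apply: (@MVT_segment R cos (fun x => - sin x) 0 u) => //.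
  exact/continuous_subspaceT/continuous_cos.
rewrite cos0 subr0 => h.
have := sin_le1 c; nra.
Qed.

Lemma normal_peakV (R : realType) (s : R) : 0 < s ->
  (normal_peak s)^-1 = s * Num.sqrt (2 * pi).
Proof.
move=> s0; rewrite /normal_peak invrK.
rewrite -mulrnAr sqrtrM ?sqr_ge0// sqrtr_sqr gtr0_norm// mulr_natl//.
Qed.

Lemma normal_funE (R : realType) (b s : R) : s != 0 ->
  normal_fun b s = (fun x => (normal_peak s)^-1 * normal_pdf b s x).
Proof.
move=> s0; apply/funext => x; rewrite normal_pdfE// mulrA mulVf ?mul1r//.
by rewrite gt_eqF// normal_peak_gt0.
Qed.

Lemma integrable_normal (R : realType) (b s : R) : s != 0 ->
  (@lebesgue_measure R).-integrable setT (EFin \o normal_fun b s).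
Proof.
move=> s0; rewrite normal_funE//.
have := integrableZl measurableT (normal_peak s)^-1 (integrable_normal_pdf b s).
by apply: eq_integrable => // x _ /=.
Qed.

Lemma Rintegral_normal (R : realType) (b s : R) : 0 < s ->
  Rintegral (@lebesgue_measure R) setT (normal_fun b s) = s * Num.sqrt (2 * pi).
Proof.
move=> s0; rewrite normal_funE ?gt_eqF// RintegralZl//; last first.
  exact: integrable_normal_pdf.
by rewrite /Rintegral integral_normal_pdf mulr1 normal_peakV.
Qed.

Lemma integrable_dominated (R : realType) (b s C : R) (h : R -> R) : s != 0 ->
  measurable_fun setT h -> (forall x, `|h x| <= C * normal_fun b s x) ->
  (@lebesgue_measure R).-integrable setT (EFin \o h).
Proof.
move=> s0 mh hC.
have := integrableZl measurableT C (integrable_normal b s0).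
apply: le_integrable => //=; first exact/measurable_EFinP.
by move=> x _; rewrite lee_fin (le_trans (hC x))// ler_norm.
Qed.

(** Doubling the width absorbs a quadratic factor: with [v = (x - b) / s], the quotient of the two
    Gaussians is [expR (3 v^2 / 8) >= 1 + 3 v^2 / 8], and three times this exceeds [v^2]. *)
Lemma normal_fun_sqr (R : realType) (b s x : R) : 0 < s ->
  ((x - b) / s) ^+ 2 * normal_fun b s x <= 3 * normal_fun b (2 * s) x.
Proof.
move=> s0; rewrite /normal_fun.
set v := (x - b) / s.
have -> : - (x - b) ^+ 2 / (s ^+ 2 *+ 2) = - (v ^+ 2 / 2).
  by rewrite /v; field; lra.
have -> : - (x - b) ^+ 2 / ((2 * s) ^+ 2 *+ 2) = 3 * v ^+ 2 / 8 - v ^+ 2 / 2.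
  by rewrite /v; field; lra.
rewrite expRD mulrA ler_pM2r ?expR_gt0//.
have := expR_ge1Dx (3 * v ^+ 2 / 8).
by have := sqr_ge0 v; lra.
Qed.

(** [cos u >= 1 - |u|] loses little near [b], where the Gaussian has its mass; far away the
    quadratic growth of the phase is absorbed by [normal_fun_sqr]. *)
Lemma Rintegral_normal_cos (R : realType) (b s : R) (u : R -> R) : 0 < s ->
  measurable_fun setT u ->
  (forall x, `|u x| <= 1/14 * (1 + ((x - b) / s) ^+ 2)) ->
  s * Num.sqrt (2 * pi) / 2 <=
    Rintegral (@lebesgue_measure R) setT (fun x => normal_fun b s x * cos (u x)).
Proof.
move=> s0 mu hu.
have s20 : 0 < 2 * s by rewrite mulr_gt0.
(* The minorant of the integrand. The wider Gaussian has twice the mass, so the integral is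
   [13/14 - 2 * 3/14 = 1/2] times the mass of the narrow one. *)
pose g x := 13/14 * normal_fun b s x - 3/14 * normal_fun b (2 * s) x.
have i1 : (@lebesgue_measure R).-integrable setT
    (EFin \o (fun x => 13/14 * normal_fun b s x)).
  exact: (integrableZl measurableT (13/14) (integrable_normal b (lt0r_neq0 s0))).
have i2 : (@lebesgue_measure R).-integrable setT
    (EFin \o (fun x => 3/14 * normal_fun b (2 * s) x)).
  exact: (integrableZl measurableT (3/14) (integrable_normal b (lt0r_neq0 s20))).
have -> : s * Num.sqrt (2 * pi) / 2 = Rintegral (@lebesgue_measure R) setT g.
  rewrite RintegralB// RintegralZl//; last exact: integrable_normal (lt0r_neq0 s0).
  rewrite RintegralZl//; last exact: integrable_normal (lt0r_neq0 s20).
  by rewrite !Rintegral_normal//; field.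
apply: le_Rintegral => //.
- exact: (integrableB _ i1 i2).
- apply: (@integrable_dominated _ b s 1); first exact: lt0r_neq0.
    apply: measurable_funM; first exact: measurable_normal_fun.
    apply: (@measurableT_comp _ _ _ _ _ _ (@cos R)) => //.
    by apply: continuous_measurable_fun; exact: continuous_cos.
  by move=> x; rewrite normrM mul1r ger0_norm ?normal_fun_ge0//
      ler_piMr ?normal_fun_ge0// cos_max.
move=> x _; rewrite /g.
have h1 := cos_ge1B (u x); have h2 := normal_fun_sqr b x s0; have h3 := normal_fun_ge0 b s x.
have h4 := hu x.
have h5 : 1 - 1/14 * (1 + ((x - b) / s) ^+ 2) <= cos (u x) by lra.
have := ler_wpM2l h3 h5.
by apply: le_trans; lra.
Qed.

(** The fundamental theorem of calculus on [[-(n+1), n+1]], where the boundary terms tend to 0;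
    dominated convergence with majorant [|f|] passes to the whole line. *)
Lemma Rintegral_derivative_eq0 (R : realType) (F f : R -> R) :
  (forall x : R, is_derive x 1 F (f x)) -> continuous f ->
  (@lebesgue_measure R).-integrable setT (EFin \o f) ->
  F n.+1%:R @[n --> \oo] --> 0 -> F (- n.+1%:R) @[n --> \oo] --> 0 ->
  Rintegral (@lebesgue_measure R) setT f = 0.
Proof.
move=> dF cf intf F0 FN0.
pose I (n : nat) : set R := [set` `[- n.+1%:R, n.+1%:R]].
pose f_ n x : \bar R := ((f \_ (I n)) x)%:E.
have mI n : measurable (I n) by exact: measurable_itv.
have mf : measurable_fun setT f by exact: continuous_measurable_fun.
have mf_ n : measurable_fun setT (f_ n).
  apply/measurable_EFinP.
  by apply/(measurable_restrict _ (mI n) measurableT); rewrite setTI; apply: measurable_funTS.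
have cvf x : f_ n x @[n --> \oo] --> (f x)%:E.
  apply: cvg_near_cst.
  near=> n; rewrite /f_ patchE mem_set// /I /= in_itv/=.
  rewrite -ler_norml (le_trans _ (_ : n%:R <= _)) ?ler_nat//.
  by near: n; exact: nbhs_infty_ger.
have [||||_ _ cvI] := @dominated_convergence _ _ _ (@lebesgue_measure R) setT
    measurableT f_ (EFin \o f) (fun x => (`|f x|)%:E) mf_.
- exact/measurable_EFinP.
- by apply: aeW => x _; exact: cvf.
- exact: integrable_norm.
- apply: aeW => x n _; rewrite lee_fin patchE; case: ifP => // _.
  by rewrite normr0.
have E n : (\int[@lebesgue_measure R]_x f_ n x = (F n.+1%:R)%:E - (F (- n.+1%:R))%:E)%E.
  rewrite /f_ (_ : (fun x => _) = (EFin \o f) \_ (I n)); last first.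
    by apply/funext => x; rewrite /= !patchE; case: ifP.
  rewrite -integral_mkcond.
  apply: continuous_FTC2.
  - by rewrite (@lt_trans _ _ 0)// ?oppr_lt0 ltr0n.
  - exact: continuous_subspaceT.
  - have cF (x : R) : {for x, continuous F}.
      by apply: differentiable_continuous; apply/derivable1_diffP; have [] := dF x.
    split; [by move=> x _; have [] := dF x | exact: cvg_at_right_filter (cF _)
      | exact: cvg_at_left_filter (cF _)].
  - by move=> x _; rewrite derive1E; have [_ ->] := dF x.
have lim0 : (\int[@lebesgue_measure R]_x f_ n x @[n --> \oo] --> 0)%E.
  under eq_fun do rewrite E -EFinB.
  rewrite -[0%E]/((0:R)%:E) -(subr0 (0:R)).
  by apply: cvg_EFin; [exact: nearW|exact: cvgB].
have := cvg_unique _ cvI lim0.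
by rewrite /Rintegral => ->.
Unshelve. all: end_near.
Qed.

Lemma normal_fun_abs (R : realType) (b s x : R) : 0 < s ->
  `|(x - b) / s| * normal_fun b s x <= 3 * normal_fun b (2 * s) x.
Proof.
move=> s0; rewrite /normal_fun.
set v := (x - b) / s.
have -> : - (x - b) ^+ 2 / (s ^+ 2 *+ 2) = - (v ^+ 2 / 2).
  by rewrite /v; field; lra.
have -> : - (x - b) ^+ 2 / ((2 * s) ^+ 2 *+ 2) = 3 * v ^+ 2 / 8 - v ^+ 2 / 2.
  by rewrite /v; field; lra.
rewrite expRD mulrA ler_pM2r ?expR_gt0//.
have := expR_ge1Dx (3 * v ^+ 2 / 8).
have := sqr_ge0 (`|v| - 1); rewrite sqrrB expr1n mulr1 real_normK ?num_real//.
by have := sqr_ge0 v; lra.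
Qed.

(** By [expR y >= 1 + y] the value is at most [2 s^2 / (u n)^2], hence at most a multiple of the
    harmonic sequence. *)
Lemma normal_fun_cvg0 (R : realType) (s : R) (u : nat -> R) : s != 0 ->
  (forall n, n.+1%:R <= u n ^+ 2) ->
  normal_fun 0 s (u n) @[n --> \oo] --> (0 : R).
Proof.
move=> s0 hu.
have h : (2 * s ^+ 2) * (harmonic n : R) @[n --> \oo] --> 0.
  rewrite -(mulr0 (2 * s ^+ 2)); apply: cvgM; first exact: cvg_cst.
  exact: cvg_harmonic.
apply: squeeze_cvgr (cvg_cst 0) h; apply: nearW => n /=.
rewrite normal_fun_ge0/= /normal_fun subr0 mulNr expRN /harmonic.
have s2 : 0 < s ^+ 2 by rewrite exprn_even_gt0.
have hn : (0 : R) < n.+1%:R by rewrite ltr0n.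
rewrite -[X in _ <= X]invrK lef_pV2 ?posrE ?expR_gt0//; last first.
  by rewrite invr_gt0 divr_gt0 ?(mulr_gt0 _ s2).
rewrite (le_trans _ (expR_ge1Dx _))// invfM invrK.
have := hu n; rewrite -[s ^+ 2 *+ 2]mulr_natl (mulrC (u n ^+ 2)).
rewrite -(ler_pM2l (_ : 0 < (2 * s ^+ 2)^-1)) ?invr_gt0 ?(mulr_gt0 _ s2)//.
by move=> h'; rewrite (le_trans h')// lerDr.
Qed.

Lemma is_derive_normal (R : realType) (s x : R) : s != 0 ->
  is_derive x 1 (normal_fun 0 s) (- x / s ^+ 2 * normal_fun 0 s x).
Proof.
move=> s0; rewrite /normal_fun.
have -> : (fun x => expR (- (x - 0) ^+ 2 / (s ^+ 2 *+ 2))) =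
   expR \o (fun x : R => (- (s ^+ 2 *+ 2)^-1) * (x * x)).
  by apply/funext => y /=; rewrite subr0 expr2; congr expR; ring.
apply: is_derive_eq.
rewrite /GRing.scale /= subr0 expr2 mulr1.
have -> : - (s ^+ 2 *+ 2)^-1 * (x * x) = - (x * x) / (s ^+ 2 *+ 2).
  by rewrite mulNr mulrC mulNr.
by field.
Qed.

Lemma is_derive_cos_affine (R : realType) (a b x : R) :
  is_derive x 1 (fun y => cos (a * y + b)) (- a * sin (a * x + b)).
Proof.
have -> : (fun y => cos (a * y + b)) = cos \o (fun y : R => a * y + b) by [].
apply: is_derive_eq.
by rewrite /GRing.scale /=; ring.
Qed.

Lemma is_derive_sin_affine (R : realType) (a b x : R) :
  is_derive x 1 (fun y => sin (a * y + b)) (a * cos (a * x + b)).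
Proof.
have -> : (fun y => sin (a * y + b)) = sin \o (fun y : R => a * y + b) by [].
apply: is_derive_eq.
by rewrite /GRing.scale /=; ring.
Qed.

Lemma is_derive_continuous (R : realType) (F f : R -> R) :
  (forall x : R, is_derive x 1 F (f x)) -> continuous F.
Proof.
move=> dF x; apply: differentiable_continuous; apply/derivable1_diffP.
by have [] := dF x.
Qed.

(** * The Fourier transform of a Gaussian, through a differential equation *)

Section gauss_fourier.
Variables (R : realType) (s : R).
Hypothesis s0 : 0 < s.
Let mu := @lebesgue_measure R.
Let g := normal_fun 0 s.

Lemma continuous_normal_fun : continuous g.
Proof. by apply: is_derive_continuous => x; exact: is_derive_normal (lt0r_neq0 s0). Qed.

Lemma continuous_cos_affine (a b : R) : continuous (fun y : R => cos (a * y + b)).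
Proof. by apply: is_derive_continuous => x; exact: is_derive_cos_affine. Qed.

Lemma continuous_sin_affine (a b : R) : continuous (fun y : R => sin (a * y + b)).
Proof. by apply: is_derive_continuous => x; exact: is_derive_sin_affine. Qed.

Lemma integrable_normalM (h : R -> R) : continuous h -> (forall x, `|h x| <= 1) ->
  mu.-integrable setT (EFin \o (fun x => g x * h x)).
Proof.
move=> ch h1; apply: (@integrable_dominated _ 0 s 1); first exact: lt0r_neq0.
  apply: continuous_measurable_fun => x; apply: cvgM; [exact: continuous_normal_fun|exact: ch].
by move=> x; rewrite normrM mul1r ger0_norm ?normal_fun_ge0// ler_piMr ?normal_fun_ge0.
Qed.

Lemma integrable_idnormalM (h : R -> R) : continuous h -> (forall x, `|h x| <= 1) ->
  mu.-integrable setT (EFin \o (fun x => x * g x * h x)).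
Proof.
move=> ch h1; apply: (@integrable_dominated _ 0 (2 * s) (s * 3)).
- by rewrite mulf_neq0// lt0r_neq0.
- apply: continuous_measurable_fun => x; apply: cvgM; [|exact: ch].
  by apply: cvgM; [exact: cvg_id|exact: continuous_normal_fun].
- move=> x; have := normal_fun_abs 0 x s0; rewrite subr0 normrM normfV (gtr0_norm s0).
  rewrite -(ler_pM2l s0) (_ : s * (`|x| * s^-1 * _) = `|x| * normal_fun 0 s x); last first.
    by field; exact: lt0r_neq0.
  rewrite mulrA; apply: le_trans; rewrite !normrM (ger0_norm (normal_fun_ge0 _ _ _)).
  by rewrite ler_piMr// mulr_ge0// normal_fun_ge0.
Qed.

Let J (theta xi : R) := Rintegral mu setT (fun x => g x * cos (xi * x + theta)).

(* Integration by parts, which makes [J theta] solve [J' = - s^2 xi J]. *)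
Let parts theta xi : xi * J theta xi =
  (s ^+ 2)^-1 * Rintegral mu setT (fun x => x * g x * sin (xi * x + theta)).
Proof.
have lim0 (h : R -> R) (u : nat -> R) : (forall x, `|h x| <= 1) ->
    (forall n, n.+1%:R <= u n ^+ 2) -> g (u n) * h (u n) @[n --> \oo] --> (0 : R).
  move=> h1 hu; apply: norm_cvg0.
  have := normal_fun_cvg0 (lt0r_neq0 s0) hu.
  apply: squeeze_cvgr (cvg_cst 0); apply: nearW => n.
  by rewrite normr_ge0/= normrM ger0_norm ?normal_fun_ge0// ler_piMr ?normal_fun_ge0.
have ic := integrable_normalM (@continuous_cos_affine xi theta) (fun x => cos_max _).
have is_ := integrable_idnormalM (@continuous_sin_affine xi theta) (fun x => sin_max _).
apply/eqP; rewrite -subr_eq0; apply/eqP.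
rewrite /J -RintegralZl// -RintegralZl// -RintegralB//; last 2 first.
- exact: (integrableZl measurableT _ ic).
- exact: (integrableZl measurableT _ is_).
apply: (@Rintegral_derivative_eq0 _ (fun x => g x * sin (xi * x + theta))).
- move=> x.
  have := is_deriveM (is_derive_normal x (lt0r_neq0 s0)) (is_derive_sin_affine xi theta x).
  move=> /is_derive_eq; apply.
  by rewrite /GRing.scale /= /g; field; exact: lt0r_neq0.
- move=> x; apply: cvgB; apply: cvgM; try exact: cvg_cst.
    by apply: cvgM; [exact: continuous_normal_fun|exact: continuous_cos_affine].
  apply: cvgM; last exact: continuous_sin_affine.
  by apply: cvgM; [exact: cvg_id|exact: continuous_normal_fun].
- have := integrableB measurableT (integrableZl measurableT xi ic)
    (integrableZl measurableT (s ^+ 2)^-1 is_).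
  by apply: eq_integrable.
- apply: (lim0 (fun x => sin (xi * x + theta)) (fun n => n.+1%:R)) => [x|n].
    exact: sin_max.
  by rewrite -natrX ler_nat expnS leq_pmulr.
- apply: (lim0 (fun x => sin (xi * x + theta)) (fun n => - n.+1%:R)) => [x|n].
    exact: sin_max.
  by rewrite sqrrN -natrX ler_nat expnS leq_pmulr.
Qed.

(** Differentiation under the integral sign, dominated by [|y * g y|], produces the sine integral
    that [parts] turns back into [J]. *)
Let derJ (theta xi : R) : is_derive xi 1 (J theta) (- (s ^+ 2 * xi) * J theta xi).
Proof.
pose f x y : R := g y * cos (x * y + theta).
have d1 (x y : R) : is_derive x 1 (f ^~ y) (- (y * g y * sin (x * y + theta))).
  have -> : f ^~ y = (fun x => g y * cos (y * x + theta)).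
    by apply/funext => z; rewrite /f (mulrC y).
  apply: is_derive_eq (is_deriveZ _ (is_derive_cos_affine _ _ _)) _.
  by rewrite /GRing.scale /= (mulrC x); ring.
have intf x : mu.-integrable setT (EFin \o f x).
  exact: integrable_normalM (@continuous_cos_affine x theta) (fun x => cos_max _).
have intG : mu.-integrable setT (EFin \o (fun y => `|y * g y|)).
  have := integrable_idnormalM (@cst_continuous _ _ (1 : R)) (fun x => _).
  rewrite normr1 => /(_ (fun=> lexx _)) /integrable_norm.
  by apply: eq_integrable => // x _ /=; rewrite mulr1.
have I : (`]xi - 1, xi + 1[%classic : set R) xi by rewrite /= in_itv/=; lra.
have G0 (y : R) : 0 <= `|y * g y| by [].
have der x (y : R) : (`]xi - 1, xi + 1[%classic : set R) x -> setT y -> derivable (f ^~ y) x 1.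
  by move=> _ _; have [] := d1 x y.
have ub x (y : R) : (`]xi - 1, xi + 1[%classic : set R) x -> setT y ->
    `|partial1of2 f x y| <= `|y * g y|.
  move=> _ _; rewrite partial1of2E; have [_ ->] := d1 x y.
  by rewrite normrN normrM ler_piMr// sin_max.
have := derivable_under_integral measurableT I (fun x _ => intf x) der G0 intG ub.
have := differentiation_under_integral measurableT I (fun x _ => intf x) der G0 intG ub.
rewrite derive1E => E D; apply: DeriveDef => //.
rewrite [LHS]E mulNr -mulrA parts mulVKf ?expf_neq0 ?lt0r_neq0// -mulN1r.
rewrite -RintegralZl//; last first.
  exact: integrable_idnormalM (@continuous_sin_affine xi theta) (fun x => sin_max _).
apply: eq_Rintegral => y _; rewrite partial1of2E; have [_ ->] := d1 xi y.
by rewrite mulN1r.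
Qed.

(** [J theta] times [expR (s^2 xi^2 / 2)] has zero derivative, so it keeps its value at 0. The phase
    [theta] puts the real and the imaginary part of the transform into one formula. *)
Lemma Rintegral_normal_fourier (theta xi : R) :
  Rintegral mu setT (fun x => g x * cos (xi * x + theta)) =
  s * Num.sqrt (2 * pi) * normal_fun 0 s^-1 xi * cos theta.
Proof.
pose H (x : R) := J theta x * expR (s ^+ 2 / 2 * (x * x)).
have dH (x : R) : is_derive x 1 H 0.
  have dE : is_derive x 1 (fun x : R => expR (s ^+ 2 / 2 * (x * x)))
      (s ^+ 2 * x * expR (s ^+ 2 / 2 * (x * x))).
    have -> : (fun x : R => expR (s ^+ 2 / 2 * (x * x))) =
      expR \o (fun x : R => (s ^+ 2 / 2) * (x * x)) by [].
    apply: is_derive_eq.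
    by rewrite /GRing.scale /=; field.
  apply: is_derive_eq (is_deriveM (derJ theta x) dE) _.
  by rewrite /GRing.scale /=; ring.
have := is_derive_0_is_cst xi 0 dH.
rewrite /H /J mulr0 mulr0 expR0 mulr1.
have -> : Rintegral mu setT (fun x => g x * cos (0 * x + theta)) =
    s * Num.sqrt (2 * pi) * cos theta.
  rewrite -(Rintegral_normal 0 s0) -RintegralZr//; last first.
    exact: integrable_normal (lt0r_neq0 s0).
  by apply: eq_Rintegral => x _; rewrite mul0r add0r.
move=> h; rewrite [LHS](_ : _ = s * Num.sqrt (2 * pi) * cos theta *
    expR (- (s ^+ 2 / 2 * (xi * xi)))).
  rewrite mulrAC; congr (_ * expR _ * _); rewrite subr0; field.
  exact: lt0r_neq0.
by rewrite -h expRN mulfK// gt_eqF// expR_gt0.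
Qed.

End gauss_fourier.

(** * Complex and iterated integrals *)

Lemma rcons_pt0 (R : realType) k (x : R) (v : 'rV[R]_k) : rcons_pt x v 0 ord0 = x.
Proof.
by rewrite mxE; case: splitP => // j _; rewrite mxE.
Qed.

Lemma rcons_ptS (R : realType) k (x : R) (v : 'rV[R]_k) (j : 'I_k) :
  rcons_pt x v 0 (lift ord0 j) = v 0 j.
Proof.
rewrite mxE; case: splitP => [i|i] /=; first by rewrite ord1.
by rewrite add1n => -[/ord_inj ->].
Qed.

Section complex_integral.
Variable R : realType.
Local Notation C := R[i].
Implicit Types (F : R -> C).
Let mu := @lebesgue_measure R.

Lemma complexReM (a b : C) : complex.Re (a * b) =
  complex.Re a * complex.Re b - complex.Im a * complex.Im b.
Proof. by case: a => ? ?; case: b. Qed.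

Lemma complexImM (a b : C) : complex.Im (a * b) =
  complex.Re a * complex.Im b + complex.Im a * complex.Re b.
Proof. by case: a => ? ?; case: b. Qed.

Lemma complexReD (a b : C) : complex.Re (a + b) = complex.Re a + complex.Re b.
Proof. by case: a => ? ?; case: b. Qed.

Lemma complexImD (a b : C) : complex.Im (a + b) = complex.Im a + complex.Im b.
Proof. by case: a => ? ?; case: b. Qed.

Lemma complexReZ (r : R) (z : C) : complex.Re (r%:C%C * z) = r * complex.Re z.
Proof. by case: z => x y /=; rewrite mul0r subr0. Qed.

Lemma complexImZ (r : R) (z : C) : complex.Im (r%:C%C * z) = r * complex.Im z.
Proof. by case: z => x y /=; rewrite mul0r addr0. Qed.

Lemma cabs1 : cabs (1 : C) = 1.
Proof. by rewrite /cabs /= expr0n/= addr0 expr1n sqrtr1. Qed.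

Lemma cabsM (a b : C) : cabs (a * b) = cabs a * cabs b.
Proof.
rewrite /cabs -sqrtrM ?addr_ge0 ?sqr_ge0// complexReM complexImM; congr Num.sqrt; ring.
Qed.

Lemma cabs_prod n (f : 'I_n -> C) : cabs (\prod_(i < n) f i) = \prod_(i < n) cabs (f i).
Proof. by apply: (big_morph _ cabsM cabs1). Qed.

Lemma cabsR (r : R) : cabs (r%:C)%C = `|r|.
Proof. by rewrite /cabs /= expr0n/= addr0 sqrtr_sqr. Qed.

Lemma Re_le_cabs (a : C) : complex.Re a <= cabs a.
Proof.
rewrite (le_trans (ler_norm _))// -sqrtr_sqr ler_wsqrtr// lerDl sqr_ge0//.
Qed.

Lemma cabs_ge0 (a : C) : 0 <= cabs a. Proof. exact: sqrtr_ge0. Qed.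

Lemma expiD (x y : R) : expi (x + y) = expi x * expi y.
Proof.
rewrite /expi cosD sinD.
by apply/eqP; rewrite eq_complex/=; apply/andP; split; apply/eqP; ring.
Qed.

Lemma expi0 : expi (0 : R) = 1. Proof. by rewrite /expi cos0 sin0. Qed.

Lemma cabs_expi (x : R) : cabs (expi x) = 1.
Proof. by rewrite /cabs /= cos2Dsin2 sqrtr1. Qed.

Lemma expi_sum n (f : 'I_n -> R) : expi (\sum_(i < n) f i) = \prod_(i < n) expi (f i).
Proof. by apply: (big_morph _ expiD expi0). Qed.

Lemma expi_int (z : int) : expi (2 * pi * z%:~R) = 1 :> C.
Proof.
have h1 : expi (2 * pi : R) = 1.
  by rewrite /expi mulr_natl cos2pi mulr2n sinDpi sinpi oppr0.
have hn (n : nat) : expi (2 * pi * n%:R : R) = 1.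
  elim: n => [|n ih]; first by rewrite mulr0 expi0.
  by rewrite -[n.+1%:R]natr1 mulrDr mulr1 expiD ih mul1r.
case: z => n; first exact: hn.
have : expi (2 * pi * n.+1%:R : R) * expi (2 * pi * (- n.+1%:Z)%:~R) = 1.
  by rewrite -expiD -mulrDr intrN subrr mulr0 expi0.
by rewrite hn mul1r -NegzE.
Qed.

Definition cintegrable F := mu.-integrable setT (EFin \o (fun x => complex.Re (F x))) /\
  mu.-integrable setT (EFin \o (fun x => complex.Im (F x))).

Definition cint1 F : C := Complex (Rintegral mu setT (fun x => complex.Re (F x)))
  (Rintegral mu setT (fun x => complex.Im (F x))).

Let integrableZ (h : R -> R) (k : R) : mu.-integrable setT (EFin \o h) ->
  mu.-integrable setT (EFin \o (fun x => k * h x)).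
Proof. by move=> ih; exact: (integrableZl measurableT k ih). Qed.

Lemma cintegrableZ (c : C) F : cintegrable F -> cintegrable (fun x => c * F x).
Proof.
move=> [iR iI]; split.
  have := integrableB measurableT (integrableZl measurableT (complex.Re c) iR)
    (integrableZl measurableT (complex.Im c) iI).
  by apply: eq_integrable => // x _; rewrite /= complexReM.
have := integrableD measurableT (integrableZl measurableT (complex.Re c) iI)
  (integrableZl measurableT (complex.Im c) iR).
by apply: eq_integrable => // x _; rewrite /= complexImM.
Qed.

Lemma cint1Z c F : cintegrable F -> cint1 (fun x => c * F x) = c * cint1 F.
Proof.
move=> [iR iI]; apply/eqP; rewrite eq_complex complexReM complexImM /=.
apply/andP; split; apply/eqP.
  rewrite (_ : (fun x => _) = fun x =>
      complex.Re c * complex.Re (F x) - complex.Im c * complex.Im (F x)).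
    by rewrite RintegralB ?RintegralZl//; exact: integrableZ.
  by apply/funext => x /=; rewrite complexReM.
rewrite (_ : (fun x => _) = fun x =>
    complex.Re c * complex.Im (F x) + complex.Im c * complex.Re (F x)).
  by rewrite RintegralD ?RintegralZl//; exact: integrableZ.
by apply/funext => x /=; rewrite complexImM.
Qed.

Lemma cintegrableD F G : cintegrable F -> cintegrable G -> cintegrable (fun x => F x + G x).
Proof.
move=> [iR iI] [jR jI]; split.
  have := integrableD measurableT iR jR.
  by apply: eq_integrable => // x _ /=; rewrite complexReD.
have := integrableD measurableT iI jI.
by apply: eq_integrable => // x _ /=; rewrite complexImD.
Qed.

Lemma cint1D F G : cintegrable F -> cintegrable G ->
  cint1 (fun x => F x + G x) = cint1 F + cint1 G.
Proof.
move=> [iR iI] [jR jI]; apply/eqP; rewrite eq_complex complexReD complexImD /=.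
by apply/andP; split; apply/eqP; rewrite -RintegralD//; congr Rintegral;
  apply/funext => x /=; rewrite ?complexReD ?complexImD.
Qed.

Lemma cintegrable0 : cintegrable (fun=> 0).
Proof. by split; exact: integrable0. Qed.

Lemma cint1_0 : cint1 (fun=> 0) = 0.
Proof.
by apply/eqP; rewrite eq_complex /= /Rintegral !integral0_eq ?eqxx.
Qed.

Lemma cintegrable_sum n (F : nat -> R -> C) : (forall k, cintegrable (F k)) ->
  cintegrable (fun x => \sum_(k < n) F k x).
Proof.
move=> iF; elim: n => [|n ih].
  rewrite (_ : (fun x => _) = fun=> 0); first exact: cintegrable0.
  by apply/funext => x; rewrite big_ord0.
rewrite (_ : (fun x => _) = fun x => \sum_(k < n) F k x + F n x).
  exact: cintegrableD.
by apply/funext => x; rewrite big_ord_recr.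
Qed.

Lemma cint1_sum n (F : nat -> R -> C) : (forall k, cintegrable (F k)) ->
  cint1 (fun x => \sum_(k < n) F k x) = \sum_(k < n) cint1 (F k).
Proof.
move=> iF; elim: n => [|n ih].
  rewrite big_ord0 -[RHS]cint1_0; congr cint1.
  by apply/funext => x; rewrite big_ord0.
rewrite big_ord_recr /= -ih -cint1D//; last exact: cintegrable_sum.
by congr cint1; apply/funext => x; rewrite big_ord_recr.
Qed.

(** The integral is iterated by definition, so each variable is split off in turn. The free constant
    [c] takes in the factor of the outer variable while the induction hypothesis treats the inner
    ones. *)
Lemma cint_Rn_prod n (F : 'I_n -> R -> C) (c : C) : (forall k, cintegrable (F k)) ->
  cint_Rn (fun v : 'rV[R]_n => c * \prod_(i < n) F i (v 0 i)) =
  c * \prod_(i < n) cint1 (F i).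
Proof.
elim: n F c => [|n ih] F c iF.
  by rewrite !big_ord0 /cint_Rn/= big_ord0; case: (c * 1).
rewrite -[LHS]/(cint1 (fun x => cint_Rn (fun v : 'rV[R]_n =>
  c * \prod_(i < n.+1) F i (rcons_pt x v 0 i)))).
rewrite big_ord_recl mulrCA mulrC.
rewrite -cint1Z//; congr cint1; apply/funext => x.
rewrite mulrAC -(ih (fun i => F (lift ord0 i)) _ (fun k => iF _)).
congr cint_Rn; apply/funext => v.
rewrite big_ord_recl rcons_pt0 mulrA; congr (_ * _).
by apply: eq_bigr => i _; rewrite rcons_ptS.
Qed.

End complex_integral.

(** * Monotonicity and product rule for iterated integrals of nonnegative functions *)

Section nonnegative_integral.
Variable R : realType.
Let mu := @lebesgue_measure R.

(* No measurability is assumed: the integral of a nonnegative function is a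
   supremum over the simple functions below it. *)
Lemma ge0_le_integral_nonmeasurable (f g : R -> \bar R) :
  (forall x, 0 <= f x)%E -> (forall x, f x <= g x)%E ->
  (\int[mu]_x f x <= \int[mu]_x g x)%E.
Proof.
move=> f0 fg; have g0 x : (0 <= g x)%E by exact: le_trans (fg x).
rewrite !ge0_integralTE//; apply: ge_ereal_sup => _ /= [h hf <-].
apply: ereal_sup_ubound; exists h => // x.
exact: le_trans (hf x) (fg x).
Qed.

Lemma int_Rn_e_ge0 n (f : 'rV[R]_n -> \bar R) :
  (forall v, 0 <= f v)%E -> (0 <= int_Rn_e f)%E.
Proof.
elim: n f => [|n ih] f f0 //=.
by apply: integral_ge0 => x _; exact: ih.
Qed.

Lemma le_int_Rn_e n (f g : 'rV[R]_n -> \bar R) :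
  (forall v, 0 <= f v)%E -> (forall v, f v <= g v)%E -> (int_Rn_e f <= int_Rn_e g)%E.
Proof.
elim: n f g => [|n ih] f g f0 fg //=.
apply: ge0_le_integral_nonmeasurable => x; first exact: int_Rn_e_ge0.
exact: ih.
Qed.

Lemma int_Rn_e_prod n (g : 'I_n -> R -> R) (G : 'I_n -> R) (c : R) : 0 <= c ->
  (forall i x, 0 <= g i x) -> (forall i, measurable_fun setT (g i)) ->
  (forall i, \int[mu]_x (g i x)%:E = (G i)%:E)%E ->
  int_Rn_e (fun v : 'rV[R]_n => (c * \prod_(i < n) g i (v 0 i))%:E) =
  (c * \prod_(i < n) G i)%:E.
Proof.
elim: n g G c => [|n ih] g G c c0 g0 mg gG; first by rewrite /= !big_ord0.
have P0 : 0 <= \prod_(i < n) G (lift ord0 i).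
  apply: prodr_ge0 => i _; rewrite -lee_fin -gG.
  by apply: integral_ge0 => x _; rewrite lee_fin.
rewrite big_ord_recl /=.
have E x : int_Rn_e (fun v : 'rV[R]_n => (c * \prod_(i < n.+1) g i (rcons_pt x v 0 i))%:E) =
   ((c * \prod_(i < n) G (lift ord0 i))%:E * (g ord0 x)%:E)%E.
  rewrite -EFinM mulrAC.
  rewrite -(ih (fun i => g (lift ord0 i)) (fun i => G (lift ord0 i))) //=;
    last exact: mulr_ge0.
  congr int_Rn_e; apply/funext => v; congr EFin.
  rewrite big_ord_recl rcons_pt0 mulrA; congr (_ * _).
  by apply: eq_bigr => i _; rewrite rcons_ptS.
under eq_integral do rewrite E.
rewrite ge0_integralZl//; first by rewrite gG -EFinM mulrAC mulrA.
- by apply/measurable_EFinP; exact: mg.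
- by move=> x _; rewrite lee_fin g0.
- by rewrite lee_fin mulr_ge0.
Qed.

End nonnegative_integral.

(** * One-dimensional sums of modulated Gaussians *)

Section lattice_wave.
Variables (R : realType) (s : R) (b : nat -> R) (K : nat).
Hypothesis s0 : 0 < s.
Local Notation C := R[i].
Let mu := @lebesgue_measure R.

(** The Gaussian has width [s^-1] in space, so that each bump of the transform has width [s]. *)
Definition wave (x : R) : C :=
  \sum_(k < K) (normal_fun 0 s^-1 x)%:C%C * expi (b k * x).

(** The Fourier transform of [wave], a real function; see [wave_fourier]. *)
Definition wave_hat (xi : R) : R :=
  Num.sqrt (2 * pi) / s * \sum_(k < K) normal_fun (b k) s xi.

(** The one-dimensional Schrodinger evolution without its factor [1 / (2 pi)]; these factors are
    collected in [schrodinger_product_wave]. *)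
Definition wave_evol (t x : R) : C :=
  cint1 (fun xi => (wave_hat xi)%:C%C * expi (xi * x + xi ^+ 2 * t)).

Let si0 : 0 < s^-1. Proof. by rewrite invr_gt0. Qed.

Let waveE x xi : wave x * expi (- (x * xi)) =
  \sum_(k < K) (normal_fun 0 s^-1 x)%:C%C * expi ((b k - xi) * x).
Proof.
rewrite mulr_suml; apply: eq_bigr => k _.
by rewrite -mulrA -expiD; congr (_ * expi _); ring.
Qed.

Lemma normal_fourier (a : R) :
  cintegrable (fun x => (normal_fun 0 s^-1 x)%:C%C * expi (a * x)) /\
  cint1 (fun x => (normal_fun 0 s^-1 x)%:C%C * expi (a * x)) =
  (Num.sqrt (2 * pi) / s * normal_fun 0 s a)%:C%C.
Proof.
have Rf : (fun x => complex.Re ((normal_fun 0 s^-1 x)%:C%C * expi (a * x))) =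
    (fun x => normal_fun 0 s^-1 x * cos (a * x + 0)).
  by apply/funext => x; rewrite complexReZ /= addr0.
(* A sine is a cosine with phase [- pi / 2], so [Rintegral_normal_fourier] covers this part too; it
   vanishes because [cos (pi / 2) = 0]. *)
have If : (fun x => complex.Im ((normal_fun 0 s^-1 x)%:C%C * expi (a * x))) =
    (fun x => normal_fun 0 s^-1 x * cos (a * x + - (pi / 2))).
  by apply/funext => x; rewrite complexImZ /= cosBpihalf.
split.
  split; rewrite ?Rf ?If.
    exact: (integrable_normalM si0 (@continuous_cos_affine _ a 0) (fun x => cos_max _)).
  exact: (integrable_normalM si0 (@continuous_cos_affine _ a (- (pi / 2))) (fun x => cos_max _)).
rewrite /cint1 Rf If !Rintegral_normal_fourier// cos0 cosN cos_pihalf mulr0 mulr1 invrK.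
by rewrite (mulrC s^-1).
Qed.

Lemma wave_fourier xi :
  cintegrable (fun x => wave x * expi (- (x * xi))) /\
  cint1 (fun x => wave x * expi (- (x * xi))) = (wave_hat xi)%:C%C.
Proof.
pose T (k : nat) (x : R) := (normal_fun 0 s^-1 x)%:C%C * expi ((b k - xi) * x).
have -> : (fun x => wave x * expi (- (x * xi))) = fun x => \sum_(k < K) T k x.
  by apply/funext => x; exact: waveE.
have iT k : cintegrable (T k) by have [] := normal_fourier (b k - xi).
split; first exact: cintegrable_sum.
rewrite cint1_sum//.
rewrite /wave_hat mulr_sumr rmorph_sum; apply: eq_bigr => k _ /=.
have [_ ->] := normal_fourier (b k - xi).
rewrite (_ : normal_fun 0 s (b k - xi) = normal_fun (b k) s xi)//.
by rewrite /normal_fun subr0 -[b k - xi]opprB sqrrN.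
Qed.

Lemma integrable_normal_expi (k : nat) (u : R -> R) : measurable_fun setT u ->
  cintegrable (fun xi => (normal_fun (b k) s xi)%:C%C * expi (u xi)).
Proof.
move=> mu_; split.
  rewrite (_ : (fun x => _) = fun x => normal_fun (b k) s x * cos (u x)); last first.
    by apply/funext => x; rewrite complexReZ.
  apply: (@integrable_dominated _ (b k) s 1); first exact: lt0r_neq0.
    apply: measurable_funM; first exact: measurable_normal_fun.
    apply: (@measurableT_comp _ _ _ _ _ _ (@cos R)) => //.
    by apply: continuous_measurable_fun; exact: continuous_cos.
  by move=> x; rewrite normrM mul1r ger0_norm ?normal_fun_ge0//
      ler_piMr ?normal_fun_ge0// cos_max.
rewrite (_ : (fun x => _) = fun x => normal_fun (b k) s x * sin (u x)); last first.
  by apply/funext => x; rewrite complexImZ.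
apply: (@integrable_dominated _ (b k) s 1); first exact: lt0r_neq0.
  apply: measurable_funM; first exact: measurable_normal_fun.
  apply: (@measurableT_comp _ _ _ _ _ _ (@sin R)) => //.
  by apply: continuous_measurable_fun; exact: continuous_sin.
by move=> x; rewrite normrM mul1r ger0_norm ?normal_fun_ge0//
  ler_piMr ?normal_fun_ge0// sin_max.
Qed.

Let mquad (p q r : R) : measurable_fun setT (fun xi : R => p + xi * q + xi ^+ 2 * r).
Proof.
apply: measurable_funD; last by apply: measurable_funM => //; exact: exprn_measurable.
by apply: measurable_funD => //; apply: measurable_funM.
Qed.

Let term t x (k : nat) (xi : R) : C :=
  (normal_fun (b k) s xi)%:C%C * expi (xi * x + xi ^+ 2 * t).

Let evolE t x : (fun xi => (wave_hat xi)%:C%C * expi (xi * x + xi ^+ 2 * t)) =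
  (fun xi => (Num.sqrt (2 * pi) / s)%:C%C * \sum_(k < K) term t x k xi).
Proof.
by apply/funext => xi; rewrite /wave_hat -mulr_suml -rmorph_sum mulrA -rmorphM.
Qed.

Let cintegrable_term t x k : cintegrable (term t x k).
Proof.
apply: integrable_normal_expi.
by have := mquad 0 x t; apply: eq_measurable_fun => xi _ /=; rewrite add0r.
Qed.

Lemma wave_evol_cintegrable t x :
  cintegrable (fun xi => (wave_hat xi)%:C%C * expi (xi * x + xi ^+ 2 * t)).
Proof. by rewrite evolE; apply: cintegrableZ; exact: cintegrable_sum. Qed.

(* The phase at [xi] is expanded around the frequency [b k]; [th k], [x + 2 b_k t]
   and [t] are the coefficients of the expansion, all small at the scale [s], so
   the cosine of the phase, up to the common factor [expi w], stays positive. *)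
Lemma wave_evol_ge (t x w : R) (th : nat -> R) :
  (forall k, (k < K)%N -> expi (b k * x + b k ^+ 2 * t) = expi w * expi (th k)) ->
  (forall k, (k < K)%N -> `|th k| <= 1/28) ->
  (forall k, (k < K)%N -> `|s * (x + 2 * b k * t)| <= 1/28) ->
  `|s ^+ 2 * t| <= 1/28 ->
  K%:R * pi <= cabs (wave_evol t x).
Proof.
move=> hw hth hx ht.
pose u k xi := th k + (xi - b k) * (x + 2 * b k * t) + (xi - b k) ^+ 2 * t.
have mu_ k : measurable_fun setT (u k).
  have := mquad (th k - b k * (x + 2 * b k * t) + b k ^+ 2 * t)
    (x + 2 * b k * t - 2 * b k * t) t.
  by apply: eq_measurable_fun => xi _; rewrite /u; ring.
rewrite /wave_evol evolE cint1Z; last exact: cintegrable_sum.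
rewrite cint1_sum//.
rewrite (_ : \sum_(k < K) _ = expi w *
    \sum_(k < K) cint1 (fun xi => (normal_fun (b k) s xi)%:C%C * expi (u k xi))); last first.
  rewrite mulr_sumr; apply: eq_bigr => k _.
  rewrite -cint1Z; last exact: integrable_normal_expi.
  congr cint1; apply/funext => xi; rewrite /term mulrCA; congr (_ * _).
  rewrite (_ : xi * x + xi ^+ 2 * t = (b k * x + b k ^+ 2 * t) +
    ((xi - b k) * (x + 2 * b k * t) + (xi - b k) ^+ 2 * t)); last by ring.
  by rewrite [LHS]expiD hw// /u -[th k + _ + _]addrA [expi (th k + _)]expiD mulrA.
have q0 : 0 <= Num.sqrt (2 * pi) / s :> R by rewrite divr_ge0 ?sqrtr_ge0// ltW.
rewrite cabsM cabsM cabs_expi mul1r cabsR ger0_norm//.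
(* With the common phase removed, every term has a large real part, so the real part bounds the
   modulus well from below. *)
apply: le_trans (ler_wpM2l q0 (Re_le_cabs _)).
rewrite (big_morph (@complex.Re R) (@complexReD R) (erefl : complex.Re (0 : C) = 0)).
have B (k : 'I_K) : s * Num.sqrt (2 * pi) / 2 <=
    complex.Re (cint1 (fun xi => (normal_fun (b k) s xi)%:C%C * expi (u k xi))).
  rewrite (_ : complex.Re _ = Rintegral mu setT (fun x => normal_fun (b k) s x * cos (u k x))).
    2: by congr Rintegral; apply/funext => xi; rewrite complexReZ.
  apply: Rintegral_normal_cos => // xi.
  have sn0 := lt0r_neq0 s0.
  set v := (xi - b k) / s.
  have -> : u k xi = th k + v * (s * (x + 2 * b k * t)) + v ^+ 2 * (s ^+ 2 * t).
    by rewrite /u /v; field.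
  have h1 := hth k (ltn_ord k); have h2 := hx k (ltn_ord k).
  rewrite (le_trans (ler_normD _ _))//.
  have h3 : `|th k + v * (s * (x + 2 * b k * t))| <= 1/28 + `|v| * (1/28).
    by rewrite (le_trans (ler_normD _ _))// lerD// normrM ler_wpM2l.
  have h4 : `|v ^+ 2 * (s ^+ 2 * t)| <= v ^+ 2 * (1/28).
    by rewrite normrM ger0_norm ?sqr_ge0// ler_wpM2l ?sqr_ge0.
  (* Since [|v| <= (1 + v^2) / 2], the bounds [1/28] with weights [1], [|v|] and [v^2] add up to at
     most [1/14 * (1 + v^2)], as [Rintegral_normal_cos] asks. *)
  have := sqr_ge0 (`|v| - 1); rewrite sqrrB expr1n mulr1 real_normK ?num_real//.
  by have := normr_ge0 v; lra.
have : \sum_(k < K) (s * Num.sqrt (2 * pi) / 2) <= \sum_(k < K)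
   complex.Re (cint1 (fun xi => (normal_fun (b k) s xi)%:C%C * expi (u k xi))).
  by apply: ler_sum => k _; exact: B.
move=> /(ler_wpM2l q0); apply: le_trans.
rewrite sumr_const card_ord -mulr_natl.
have e : Num.sqrt (2 * pi) ^+ 2 = 2 * pi :> R by rewrite sqr_sqrtr// mulr_ge0// pi_ge0.
rewrite (_ : Num.sqrt (2 * pi) / s * _ = K%:R * (Num.sqrt (2 * pi) ^+ 2 / 2)).
  by rewrite e; lra.
by field; exact: lt0r_neq0.
Qed.

End lattice_wave.

(** * Near orthogonality of separated Gaussians and the weighted square norm *)

Lemma normal_funM_le (R : realType) (b b' s x K : R) : 0 < s -> 0 < K ->
  K * s ^+ 2 <= (b - b') ^+ 2 ->
  normal_fun b s x * normal_fun b' s x <=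
    4 / K * (normal_fun b s x + normal_fun b' s x).
Proof.
move=> s0 K0 hK.
set p := expR (- ((x - b) ^+ 2 / (4 * s ^+ 2))).
set q := expR (- ((x - b') ^+ 2 / (4 * s ^+ 2))).
have sn0 := lt0r_neq0 s0.
have -> : normal_fun b s x = p ^+ 2.
  by rewrite /normal_fun /p -expRM_natl; congr expR; field.
have -> : normal_fun b' s x = q ^+ 2.
  by rewrite /normal_fun /q -expRM_natl; congr expR; field.
(* [p] and [q] are the square roots of the Gaussians. The sum of the squared distances from [x] to
   the centres is at least [(b - b')^2 / 2], which makes [p * q] small; one such factor of
   [(p * q)^2] is spent here, and the other is at most [(p^2 + q^2) / 2]. *)
have pq : p * q <= 8 / K.
  rewrite /p /q -expRD -opprD expRN -[X in _ <= X]invrK lef_pV2 ?posrE ?expR_gt0//; last first.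
    by rewrite invr_gt0 divr_gt0.
  rewrite (le_trans _ (expR_ge1Dx _))// invfM invrK -mulrDl.
  have s2 : 0 < s ^+ 2 by rewrite exprn_gt0.
  rewrite (@le_trans _ _ (((x - b) ^+ 2 + (x - b') ^+ 2) / (4 * s ^+ 2)))//;
    last by rewrite lerDr.
  rewrite ler_pdivlMr ?mulr_gt0//.
  have := sqr_ge0 ((x - b) + (x - b')).
  by move: hK; lra.
have p0 : 0 <= p by exact: expR_ge0.
have q0 : 0 <= q by exact: expR_ge0.
rewrite -exprMn expr2 (le_trans (ler_wpM2r (mulr_ge0 p0 q0) pq))//.
have k0 : 0 <= K^-1 by rewrite invr_ge0 ltW.
rewrite -subr_ge0 (_ : _ - _ = 4 / K * (p - q) ^+ 2); last by ring.
by rewrite mulr_ge0 ?sqr_ge0// mulr_ge0.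
Qed.

(* The centres are so far apart that the off-diagonal products [g_k g_l] are
   negligible. *)
Lemma sum_normal_fun_sqr (R : realType) (a L s x : R) (K : nat) : 0 < s ->
  K%:R * s ^+ 2 <= L ^+ 2 ->
  (\sum_(k < K) normal_fun (a + L * k%:R) s x) ^+ 2 <=
    9 * \sum_(k < K) normal_fun (a + L * k%:R) s x.
Proof.
move=> s0 hK.
have [->|Kn0] := eqVneq K 0%N; first by rewrite !big_ord0 expr0n mulr0.
have K0 : (0 : R) < K%:R by rewrite ltr0n lt0n.
pose g (k : 'I_K) := normal_fun (a + L * k%:R) s x.
rewrite -/(g _) -[\sum_(k < K) _]/(\sum_(k < K) g k).
have gn0 k : 0 <= g k by exact: normal_fun_ge0.
(* Summed over [k] and [l], the diagonal terms give [S] and the others [4 S + 4 S], whence the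
   constant 9. *)
have B (k l : 'I_K) : g k * g l <= (k == l)%:R * g k + 4 / K%:R * (g k + g l).
  have [<-|kl] := eqVneq k l.
    rewrite mul1r (le_trans (_ : _ <= g k))//.
      rewrite ler_piMl// /g /normal_fun -[leRHS]expR0 ler_expR mulNr oppr_le0.
      by rewrite divr_ge0 ?sqr_ge0// mulrn_wge0// sqr_ge0.
    by rewrite lerDl mulr_ge0 ?addr_ge0// divr_ge0// ltW.
  rewrite mul0r add0r; apply: normal_funM_le => //.
  rewrite (_ : (_ - _) ^+ 2 = L ^+ 2 * (k%:R - l%:R) ^+ 2); last by ring.
  rewrite (le_trans hK)// ler_peMr ?sqr_ge0//.
  wlog lt_kl : k l kl / (k < l)%N.
    move=> H; have [/H|lt_lk|e] := ltngtP k l; first exact.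
      by rewrite -sqrrN opprB; apply: H => //; rewrite eq_sym.
    by move: kl; rewrite (val_inj e) eqxx.
  rewrite -sqrrN opprB -natrB ?(ltnW lt_kl)// -natrX ler1n expn_gt0 subn_gt0 lt_kl//.
rewrite expr2 mulr_suml.
apply: (@le_trans _ _ (\sum_(k < K) \sum_(l < K)
    ((k == l)%:R * g k + 4 / K%:R * (g k + g l)))).
  by apply: ler_sum => k _; rewrite mulr_sumr; apply: ler_sum => l _; exact: B.
set S := \sum_(k < K) g k.
have E k : \sum_(l < K) ((k == l)%:R * g k + 4 / K%:R * (g k + g l)) = 5 * g k + 4 / K%:R * S.
  rewrite big_split/= -mulr_suml -mulr_sumr big_split/= sumr_const card_ord -/S.
  rewrite (bigD1 k)//= eqxx big1 ?addr0 ?mul1r; last by move=> i /negbTE; rewrite eq_sym => ->.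
  by rewrite -mulr_natr; field; exact: lt0r_neq0.
under eq_bigr do rewrite E.
rewrite big_split/= -mulr_sumr sumr_const card_ord -/S -mulr_natr.
rewrite le_eqVlt; apply/orP; left; apply/eqP.
by field; exact: lt0r_neq0.
Qed.

Section weighted_norm.
Variables (R : realType) (s a L P B : R) (K : nat).
Hypotheses (s0 : 0 < s) (sP : s <= P) (sepL : K%:R * s ^+ 2 <= L ^+ 2).
Hypothesis bP : forall k, (k < K)%N -> `|a + L * k%:R| <= B * P.
Let mu := @lebesgue_measure R.
Let b k := a + L * k%:R.

(** The factor [18 * pi] is the [2 * pi] of the squared transform times the 9 of
    [sum_normal_fun_sqr]; the Gaussians of width [2 * s] pay for the weight. *)
Definition wave_majorant (xi : R) : R := 18 * pi / s ^+ 2 *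
  \sum_(k < K) ((1 + 2 * B ^+ 2) * normal_fun (b k) s xi + 6 * normal_fun (b k) (2 * s) xi).

Lemma wave_majorant_ge0 xi : 0 <= wave_majorant xi.
Proof.
apply: mulr_ge0; first by rewrite divr_ge0 ?sqr_ge0 ?mulr_ge0 ?pi_ge0.
apply: sumr_ge0 => k _; rewrite addr_ge0// mulr_ge0 ?normal_fun_ge0//.
by rewrite addr_ge0// mulr_ge0 ?sqr_ge0.
Qed.

(** Around each centre [|b k| <= B P] and [|xi - b k| = |v| s <= |v| P], so
    [xi^2 / P^2 <= 2 B^2 + 2 v^2]; then [normal_fun_sqr] trades [2 v^2] for [6] wider Gaussians. *)
Lemma wave_hat_weight (xi : R) :
  (1 + xi ^+ 2 / P ^+ 2) * wave_hat s b K xi ^+ 2 <= wave_majorant xi.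
Proof.
have P0 : 0 < P := lt_le_trans s0 sP.
have w0 : 0 <= 1 + xi ^+ 2 / P ^+ 2 by rewrite addr_ge0// divr_ge0// sqr_ge0.
rewrite /wave_hat exprMn exprMn sqr_sqrtr; last by rewrite mulr_ge0// pi_ge0.
have S := @sum_normal_fun_sqr R a L s xi K s0 sepL.
have c0 : 0 <= 2 * pi * s^-1 ^+ 2 :> R by rewrite mulr_ge0 ?sqr_ge0// mulr_ge0// pi_ge0.
rewrite mulrCA (le_trans (ler_wpM2l c0 (ler_wpM2l w0 S)))//.
rewrite /wave_majorant.
rewrite (_ : 18 * pi / s ^+ 2 * _ = (2 * pi * s^-1 ^+ 2) * (9 * \sum_(k < K)
    ((1 + 2 * B ^+ 2) * normal_fun (b k) s xi + 6 * normal_fun (b k) (2 * s) xi)));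
  last first.
  by field; exact: lt0r_neq0.
rewrite ler_wpM2l// mulrCA ler_wpM2l// mulr_sumr; apply: ler_sum => k _.
have g0 := normal_fun_ge0 (b k) s xi.
have h1 := normal_fun_sqr (b k) xi s0.
set v := (xi - b k) / s in h1 *.
have P2 : 0 < P ^+ 2 by rewrite exprn_gt0.
have hb : b k ^+ 2 <= B ^+ 2 * P ^+ 2.
  rewrite -exprMn -[b k ^+ 2]real_normK ?num_real// ler_sqr ?nnegrE//.
    exact: bP.
  by rewrite (le_trans _ (bP (ltn_ord k))).
have hv : (xi - b k) ^+ 2 <= v ^+ 2 * P ^+ 2.
  rewrite (_ : (xi - b k) = v * s); last by rewrite /v divfK// lt0r_neq0.
  by rewrite exprMn ler_wpM2l ?sqr_ge0// ler_sqr ?nnegrE// ltW.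
have hx : xi ^+ 2 / P ^+ 2 <= 2 * B ^+ 2 + 2 * v ^+ 2.
  rewrite ler_pdivrMr//.
  have := sqr_ge0 (2 * b k - xi).
  by move: hb hv; lra.
have := ler_wpM2r g0 hx.
by rewrite -/(b k); lra.
Qed.

Lemma integral_EFin (h : R -> R) : mu.-integrable setT (EFin \o h) ->
  (\int[mu]_x (h x)%:E = (Rintegral mu setT h)%:E)%E.
Proof. by move=> ih; rewrite /Rintegral fineK// integrable_fin_num. Qed.

Lemma measurable_wave_majorant : measurable_fun setT wave_majorant.
Proof.
apply: measurable_funM => //; apply: measurable_sum => k.
by apply: measurable_funD; apply: measurable_funM => //; exact: measurable_normal_fun.
Qed.

Lemma integral_wave_majorant : (\int[mu]_x (wave_majorant x)%:E =
  (18 * pi * (13 + 2 * B ^+ 2) * Num.sqrt (2 * pi) * (K%:R / s))%:E)%E.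
Proof.
have s20 : 0 < 2 * s by rewrite mulr_gt0.
have c0 : 0 <= 18 * pi / s ^+ 2 by rewrite divr_ge0 ?sqr_ge0 ?mulr_ge0 ?pi_ge0.
have B0 : 0 <= 1 + 2 * B ^+ 2 by rewrite addr_ge0// mulr_ge0 ?sqr_ge0.
have m1 k : measurable_fun setT (fun x => (1 + 2 * B ^+ 2) * normal_fun (b k) s x).
  by apply: measurable_funM => //; exact: measurable_normal_fun.
have m2 k : measurable_fun setT (fun x => 6 * normal_fun (b k) (2 * s) x).
  by apply: measurable_funM => //; exact: measurable_normal_fun.
have m12 k := measurable_funD (m1 k) (m2 k).
have p1 k x : (0 <= ((1 + 2 * B ^+ 2) * normal_fun (b k) s x)%:E)%E.
  by rewrite lee_fin mulr_ge0// normal_fun_ge0.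
have p2 k x : (0 <= (6 * normal_fun (b k) (2 * s) x)%:E)%E.
  by rewrite lee_fin mulr_ge0// normal_fun_ge0.
rewrite /wave_majorant.
under eq_integral do rewrite EFinM.
rewrite ge0_integralZl//; last 2 first.
- by apply/measurable_EFinP; apply: measurable_sum => k; exact: m12.
- by move=> x _; rewrite lee_fin; apply: sumr_ge0 => k _; rewrite addr_ge0// -lee_fin.
under eq_integral do rewrite -sumEFin.
rewrite ge0_integral_sum//; last 2 first.
- by move=> k; apply/measurable_EFinP; exact: m12.
- by move=> k x _; rewrite EFinD adde_ge0.
(* The wider Gaussian has twice the mass: [(1 + 2 B^2) + 6 * 2 = 13 + 2 B^2]. *)
have E (k : 'I_K) : (\int[mu]_x
      ((1 + 2 * B ^+ 2) * normal_fun (b k) s x + 6 * normal_fun (b k) (2 * s) x)%:E =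
    ((13 + 2 * B ^+ 2) * (s * Num.sqrt (2 * pi)))%:E)%E.
  under eq_integral do rewrite EFinD.
  rewrite ge0_integralD//; [|by apply/measurable_EFinP; exact: m1
    |by apply/measurable_EFinP; exact: m2].
  have i1 := integrable_normal (b k) (lt0r_neq0 s0).
  have i2 := integrable_normal (b k) (lt0r_neq0 s20).
  rewrite integral_EFin; last exact: (integrableZl measurableT (1 + 2 * B ^+ 2) i1).
  rewrite integral_EFin; last exact: (integrableZl measurableT 6 i2).
  rewrite !RintegralZl// !Rintegral_normal// -EFinD; congr EFin; ring.
under eq_bigr do rewrite E.
rewrite sumEFin -EFinM sumr_const card_ord -mulr_natl; congr EFin; field.
exact: lt0r_neq0.
Qed.

End weighted_norm.

(** * Schwartz functions of Gaussian type *)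

Section trigonometric_polynomials.
Variables (R : realType) (n : nat).
Local Notation V := 'rV[R]_n.

Lemma derive_comp_real (h : R -> R) (h' : R) (g : V -> R) (x v : V) :
  is_derive (g x) 1 h h' -> differentiable g x ->
  differentiable (h \o g) x /\ 'D_v (h \o g) x = h' * 'D_v g x.
Proof.
move=> [dh eh] dg.
have dh' : differentiable h (g x) by apply/derivable1_diffP.
have dhg : differentiable (h \o g) x by exact: differentiable_comp.
split => //; rewrite deriveE// diff_comp// [LHS]/= -(deriveE v dg).
have -> : 'D_v g x = 'D_v g x *: (1 : R) by rewrite /GRing.scale /= mulr1.
by rewrite linearZ/= -deriveE// eh /GRing.scale /= mulr1 mulrC.
Qed.

Lemma derive_coord (i : 'I_n) (x v : V) :
  differentiable (fun y : V => y 0 i : R) x /\ 'D_v (fun y : V => y 0 i : R) x = v 0 i.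
Proof.
split; first exact: differentiable_coord.
rewrite /derive; apply: cvg_lim => //; apply: cvg_near_cst; near=> h.
have h0 : h != 0 by near: h; exact: nbhs_dnbhs_neq.
by rewrite /= !mxE addrK /GRing.scale /= mulrA mulVf// mul1r.
Unshelve. all: end_near. Qed.

(** A class containing the polynomials and the modulations and closed under derivatives, so that
    every partial derivative of a modulated Gaussian is a member times the same Gaussian. *)
Inductive trig_poly : (V -> R) -> Prop :=
| tp_cst (c : R) : trig_poly (fun=> c)
| tp_coord (i : 'I_n) : trig_poly (fun x => x 0 i)
| tp_cos (b : R) (i : 'I_n) : trig_poly (fun x => cos (b * x 0 i))
| tp_sin (b : R) (i : 'I_n) : trig_poly (fun x => sin (b * x 0 i))
| tp_add p q : trig_poly p -> trig_poly q -> trig_poly (fun x => p x + q x)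
| tp_mul p q : trig_poly p -> trig_poly q -> trig_poly (fun x => p x * q x).

Lemma trig_poly_derive p (v : V) : trig_poly p ->
  exists2 p', trig_poly p' & forall x, differentiable p x /\ 'D_v p x = p' x.
Proof.
elim => {p} [c|i|b i|b i|p q _ [p' tp' hp] _ [q' tq' hq]|p q tp [p' tp' hp] tq [q' tq' hq]].
- exists (fun=> 0); first exact: tp_cst.
  by move=> x; split; [exact: differentiable_cst|exact: derive_cst].
- exists (fun=> v 0 i); first exact: tp_cst.
  by move=> x; exact: derive_coord.
- exists (fun x => (- b * v 0 i) * sin (b * x 0 i)).
    exact: tp_mul (tp_cst _) (tp_sin _ _).
  move=> x; have [d1 d2] := derive_coord i x v.
  have h := is_derive_cos_affine b 0 (x 0 i).
  have := @derive_comp_real _ _ (fun y : V => y 0 i) x v h d1.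
  rewrite /comp d2 addr0; under [fun y : V => cos _]eq_fun do rewrite addr0.
  by move=> [? ->]; split => //; ring.
- exists (fun x => (b * v 0 i) * cos (b * x 0 i)).
    exact: tp_mul (tp_cst _) (tp_cos _ _).
  move=> x; have [d1 d2] := derive_coord i x v.
  have h := is_derive_sin_affine b 0 (x 0 i).
  have := @derive_comp_real _ _ (fun y : V => y 0 i) x v h d1.
  rewrite /comp d2 addr0; under [fun y : V => sin _]eq_fun do rewrite addr0.
  by move=> [? ->]; split => //; ring.
- exists (fun x => p' x + q' x); first exact: tp_add.
  move=> x; have [dp ep] := hp x; have [dq eq_] := hq x.
  split; first exact: differentiableD.
  by rewrite -ep -eq_; apply: deriveD; exact: diff_derivable.
- exists (fun x => p x * q' x + q x * p' x).
    by apply: tp_add; exact: tp_mul.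
  move=> x; have [dp ep] := hp x; have [dq eq_] := hq x.
  split; first exact: differentiableM.
  by rewrite -ep -eq_; apply: deriveM; exact: diff_derivable.
Qed.

Lemma normsq_ge0 (x : V) : 0 <= normsq x.
Proof. by apply: sumr_ge0 => i _; rewrite -expr2 sqr_ge0. Qed.

Lemma coord_le_normsq (x : V) (i : 'I_n) : x 0 i ^+ 2 <= normsq x.
Proof.
rewrite /normsq /dotR (bigD1 i)//= -expr2 lerDl.
by apply: sumr_ge0 => j _; rewrite -expr2 sqr_ge0.
Qed.

(** The rate [e] is arbitrary, which lets a product share it between its two factors. *)
Lemma trig_poly_bound p (e : R) : trig_poly p -> 0 < e ->
  exists2 c, 0 <= c & forall x, `|p x| <= c * expR (e * normsq x).
Proof.
have e1 (a : R) (x : V) : 0 <= a -> 1 <= expR (a * normsq x).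
  by move=> a0; rewrite -[leLHS]expR0 ler_expR; apply: mulr_ge0 => //; exact: normsq_ge0.
move=> tp; elim: tp e => {p} [c|i|b i|b i|p q _ hp _ hq|p q _ hp _ hq] e e0.
- by exists `|c| => // x; rewrite ler_peMr// e1// ltW.
- exists (1 + e^-1); first by rewrite addr_ge0// invr_ge0 ltW.
  move=> x; have h := expR_ge1Dx (e * normsq x).
  have h2 := coord_le_normsq x i.
  apply: (@le_trans _ _ ((1 + e^-1) * (1 + e * normsq x))); last first.
    by rewrite ler_wpM2l// addr_ge0// invr_ge0 ltW.
  rewrite mulrDl mul1r mulrDr mulr1 mulrA mulVf ?lt0r_neq0// mul1r.
  have := sqr_ge0 (`|x 0 i| - 1); rewrite sqrrB expr1n mulr1 real_normK ?num_real//.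
  have : 0 <= e * normsq x by rewrite mulr_ge0 ?normsq_ge0// ltW.
  by have : 0 <= e^-1 by [rewrite invr_ge0 ltW|]; have := normr_ge0 (x 0 i); lra.
- by exists 1 => // x; rewrite mul1r (le_trans (cos_max _))// e1// ltW.
- by exists 1 => // x; rewrite mul1r (le_trans (sin_max _))// e1// ltW.
- have [c c0 hc] := hp e e0; have [d d0 hd] := hq e e0.
  exists (c + d); first exact: addr_ge0.
  by move=> x; rewrite (le_trans (ler_normD _ _))// mulrDl lerD.
- have e20 : 0 < e / 2 by rewrite divr_gt0.
  have [c c0 hc] := hp _ e20; have [d d0 hd] := hq _ e20.
  exists (c * d); first exact: mulr_ge0.
  move=> x; rewrite normrM [X in expR (X * _)](splitr e) mulrDl expRD mulrACA.
  exact: ler_pM.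
Qed.

Lemma trig_poly_sum (I : Type) (r : seq I) (F : I -> V -> R) :
  (forall i, trig_poly (F i)) -> trig_poly (fun x => \sum_(i <- r) F i x).
Proof.
move=> tF; elim: r => [|i r ih].
  by under eq_fun do rewrite big_nil; exact: tp_cst.
by under eq_fun do rewrite big_cons; exact: tp_add.
Qed.

Lemma trig_poly_exp p m : trig_poly p -> trig_poly (fun x => p x ^+ m).
Proof.
move=> tp; elim: m => [|m ih]; first exact: tp_cst.
by under eq_fun do rewrite exprS; exact: tp_mul.
Qed.

Lemma trig_poly_prod (I : Type) (r : seq I) (F : I -> V -> R) :
  (forall i, trig_poly (F i)) -> trig_poly (fun x => \prod_(i <- r) F i x).
Proof.
move=> tF; elim: r => [|i r ih].
  by under eq_fun do rewrite big_nil; exact: tp_cst.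
by under eq_fun do rewrite big_cons; exact: tp_mul.
Qed.

(** The form [r * expR (- q)] with [r] in the class is preserved by derivatives ([G]), and
    [trig_poly_bound] at rate [d] makes the growth of [r] and of the monomials lose against
    [expR (- q)]. *)
Lemma schwartz_gauss (p q : V -> R) (d : R) : trig_poly p -> trig_poly q -> 0 < d ->
  (forall x, d * normsq x <= q x) -> schwartz_real (fun x => p x * expR (- q x)).
Proof.
move=> tp tq d0 dq.
pose G (g : V -> R) := exists2 r, trig_poly r & g = fun x => r x * expR (- q x).
have Gd g (v : V) : G g -> (forall x, differentiable g x) /\ G (fun x => 'D_v g x).
  move=> [r tr ->].
  have [r' tr' hr] := trig_poly_derive v tr.
  have [q' tq' hq] := trig_poly_derive v tq.
  have E x : differentiable (fun y => expR (- q y)) x /\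
      'D_v (fun y => expR (- q y)) x = - q' x * expR (- q x).
    have [dq1 dq2] := hq x.
    have dNq : differentiable (fun y => - q y) x by exact: differentiableN.
    have [? e] := derive_comp_real v (is_derive_expR (- q x)) dNq.
    split => //; rewrite [LHS]e mulrC -dq2; congr (_ * _).
    by apply: deriveN; exact: diff_derivable.
  split.
    by move=> x; have [? _] := hr x; have [? _] := E x; exact: differentiableM.
  exists (fun x => r' x + - 1 * (r x * q' x)).
    by apply: tp_add => //; apply: tp_mul; [exact: tp_cst|exact: tp_mul].
  apply/funext => x; have [d1 e1] := hr x; have [d2 e2] := E x.
  rewrite -[LHS]/('D_v (r * (fun y => expR (- q y))) x).
  rewrite deriveM; [|exact: diff_derivable|exact: diff_derivable].
  by rewrite e1 e2 /GRing.scale /=; ring.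
have Gal (al : seq 'I_n) : G (pderiv al (fun x => p x * expR (- q x))).
  elim: al => [|i al ih]; first by exists p.
  by have [_] := Gd _ (delta_mx 0 i) ih.
(* The direction 0 is a dummy: only differentiability is extracted. *)
split; first by move=> al x; have [+ _] := Gd _ 0 (Gal al); apply.
move=> al beta; have [r tr ->] := Gal al.
have tM : trig_poly (fun x => (\prod_(i < n) x 0 i ^+ beta i) * r x).
  apply: tp_mul => //; apply: (@trig_poly_prod _ _ (fun (i : 'I_n) x => x 0 i ^+ beta i)) => i.
  by apply: trig_poly_exp; exact: tp_coord.
have [c c0 hc] := trig_poly_bound tM d0.
exists c => x; rewrite mulrA normrM (ger0_norm (expR_ge0 _)).
rewrite (le_trans (ler_wpM2r (expR_ge0 _) (hc x)))// -mulrA -expRD ler_piMr//.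
by rewrite -[leRHS]expR0 ler_expR subr_le0.
Qed.

End trigonometric_polynomials.

(** * Tensor products of waves *)

Lemma expR_sum_ord (R : realType) n (F : 'I_n -> R) :
  expR (\sum_(i < n) F i) = \prod_(i < n) expR (F i).
Proof. by apply: (big_morph _ (@expRD R) (expR0 R)). Qed.

(** Replaces the radial weight of the Sobolev norm by a product of one-dimensional weights. *)
Lemma ler1D_sum_prod (R : realType) n (a : 'I_n -> R) : (forall i, 0 <= a i) ->
  1 + \sum_(i < n) a i <= \prod_(i < n) (1 + a i).
Proof.
elim: n a => [|n ih] a a0; first by rewrite !big_ord0 addr0.
rewrite !big_ord_recl.
have a1 : 0 <= 1 + a ord0 by rewrite addr_ge0.
apply: le_trans (ler_wpM2l a1 (ih _ (fun i => a0 _))).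
have : 0 <= \sum_(i < n) a (lift ord0 i) by exact: sumr_ge0.
by move=> h; have := mulr_ge0 (a0 ord0) h; lra.
Qed.

Lemma powR_le1D (R : realType) (y r : R) : 0 <= y -> 0 <= r <= 1 -> y `^ r <= 1 + y.
Proof.
move=> y0 /andP[r0 r1]; have [y1|y1] := leP y 1.
  rewrite (le_trans (_ : _ <= 1))//; last by rewrite lerDl.
  have -> : 1 = 1 `^ r :> R by rewrite powR1.
  by apply: ge0_ler_powR; rewrite ?nnegrE.
rewrite (le_trans (_ : _ <= y `^ 1))//; first by apply: ler_powR => //; exact: ltW.
by rewrite powRr1// lerDr.
Qed.

Section product_wave.
Variables (R : realType) (n : nat) (s a : 'I_n -> R) (L : R) (K : 'I_n -> nat).
Local Notation C := R[i].
Let b i (k : nat) := a i + L * k%:R.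

Definition product_wave (x : 'rV[R]_n) : C :=
  \prod_(i < n) wave (s i) (b i) (K i) (x 0 i).

Hypothesis s1 : forall i, 1 <= s i.
Let s0 i : 0 < s i. Proof. exact: lt_le_trans (s1 i). Qed.

Let ctp (F : 'rV[R]_n -> C) := trig_poly (fun x => complex.Re (F x)) /\
  trig_poly (fun x => complex.Im (F x)).

Let ctp_sum m (F : 'I_m -> 'rV[R]_n -> C) : (forall k, ctp (F k)) ->
  ctp (fun x => \sum_(k < m) F k x).
Proof.
move=> tF; split.
  under eq_fun do rewrite (big_morph (@complex.Re R) (@complexReD R)
    (erefl : complex.Re (0 : C) = 0)).
  by apply: trig_poly_sum => k; have [] := tF k.
under eq_fun do rewrite (big_morph (@complex.Im R) (@complexImD R)
    (erefl : complex.Im (0 : C) = 0)).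
by apply: trig_poly_sum => k; have [] := tF k.
Qed.

Let ctpM F G : ctp F -> ctp G -> ctp (fun x => F x * G x).
Proof.
move=> [fr fi] [gr gi]; split.
  under eq_fun do rewrite complexReM -mulN1r.
  by apply: tp_add; [exact: tp_mul|apply: tp_mul; [exact: tp_cst|exact: tp_mul]].
under eq_fun do rewrite complexImM.
by apply: tp_add; exact: tp_mul.
Qed.

Let ctp_prod m (F : 'I_m -> 'rV[R]_n -> C) : (forall k, ctp (F k)) ->
  ctp (fun x => \prod_(k < m) F k x).
Proof.
elim: m F => [|m ih] F tF.
  under eq_fun do rewrite big_ord0.
  by split; exact: tp_cst.
under eq_fun do rewrite big_ord_recl.
by apply: ctpM => //; exact: ih.
Qed.

(** All the Gaussians gather in one factor [expR (- q)], and the exponentials form [T]; [s i >= 1]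
    makes [q] at least half the squared norm. *)
Lemma schwartz_product_wave : schwartz product_wave.
Proof.
pose q (x : 'rV[R]_n) := \sum_(i < n) (s i ^+ 2 / 2) * (x 0 i * x 0 i).
pose T (x : 'rV[R]_n) : C := \prod_(i < n) \sum_(k < K i) expi (b i k * x 0 i).
have [TR TI] : ctp T.
  apply: (ctp_prod (F := fun i x => \sum_(k < K i) expi (b i k * x 0 i))) => i.
  apply: (ctp_sum (F := fun k x => expi (b i k * x 0 i))) => k.
  by split; [exact: tp_cos|exact: tp_sin].
have tq : trig_poly q.
  apply: (@trig_poly_sum R n _ _ (fun i x => (s i ^+ 2 / 2) * (x 0 i * x 0 i))) => i.
  by apply: tp_mul; [exact: tp_cst|apply: tp_mul; exact: tp_coord].
have hq (x : 'rV[R]_n) : 1 / 2 * normsq x <= q x.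
  rewrite /normsq /dotR mulr_sumr; apply: ler_sum => i _.
  rewrite -expr2 ler_wpM2r ?sqr_ge0// ler_pM2r//.
  by rewrite expr_ge1// (le_trans _ (s1 i)).
have E x : product_wave x = (expR (- q x))%:C%C * T x.
  rewrite /product_wave /q -sumrN expR_sum_ord rmorph_prod -big_split/=.
  apply: eq_bigr => i _; rewrite /wave -mulr_sumr; congr (_%:C%C * _).
  rewrite /normal_fun subr0; congr expR; field; exact: lt0r_neq0.
split.
  under [X in schwartz_real X]eq_fun do rewrite E complexReZ mulrC.
  by apply: (schwartz_gauss TR tq _ hq); lra.
under [X in schwartz_real X]eq_fun do rewrite E complexImZ mulrC.
by apply: (schwartz_gauss TI tq _ hq); lra.
Qed.

Lemma fourier_product_wave xi : fourier product_wave xi =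
  (\prod_(i < n) wave_hat (s i) (b i) (K i) (xi 0 i))%:C%C.
Proof.
rewrite /fourier.
pose F i y := wave (s i) (b i) (K i) y * expi (- (y * xi 0 i)).
have -> : (fun x => product_wave x * expi (- dotR x xi)) =
    (fun x : 'rV[R]_n => 1 * \prod_(i < n) F i (x 0 i)).
  apply/funext => x; rewrite mul1r big_split/=; congr (_ * _).
  by rewrite /dotR -sumrN expi_sum.
rewrite cint_Rn_prod; last by move=> i; have [] := wave_fourier (b i) (K i) (s0 i) (xi 0 i).
rewrite mul1r rmorph_prod; apply: eq_bigr => i _.
by have [] := wave_fourier (b i) (K i) (s0 i) (xi 0 i).
Qed.

Lemma schrodinger_product_wave t x : schrodinger t product_wave x =
  (((2 * pi) ^- n)%:C)%C * \prod_(i < n) wave_evol (s i) (b i) (K i) t (x 0 i).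
Proof.
rewrite /schrodinger; congr (_ * _).
pose F i y := (wave_hat (s i) (b i) (K i) y)%:C%C * expi (y * x 0 i + y ^+ 2 * t).
have -> : (fun xi => fourier product_wave xi * expi (dotR xi x + normsq xi * t)) =
    (fun xi : 'rV[R]_n => 1 * \prod_(i < n) F i (xi 0 i)).
  apply/funext => xi; rewrite fourier_product_wave mul1r rmorph_prod [RHS]big_split.
  congr (_ * _); rewrite /normsq /dotR mulr_suml -big_split/= expi_sum.
  by apply: eq_bigr => i _; rewrite expr2.
rewrite cint_Rn_prod; last by move=> i; exact: wave_evol_cintegrable.
by rewrite mul1r.
Qed.

(** Scaling by [P^2] and [powR_le1D] bound the weight by [(P^2)^r] times [1 + (1 + |xi|^2) / P^2],
    which is at most [2 * \prod (1 + xi_i^2 / P^2)]. The integral then factors into those of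
    [wave_majorant]. *)
Lemma sobolev_product_wave (P B r : R) : 1 <= P -> 0 <= r <= 1 ->
  (forall i, s i <= P) -> (forall i, (K i)%:R * s i ^+ 2 <= L ^+ 2) ->
  (forall i k, (k < K i)%N -> `|b i k| <= B * P) ->
  (sobolev_normsq r product_wave <= ((2 * pi) ^- n * (2 * (P ^+ 2) `^ r *
    \prod_(i < n) (18 * pi * (13 + 2 * B ^+ 2) * Num.sqrt (2 * pi) * ((K i)%:R / s i))))%:E)%E.
Proof.
move=> P1 r01 sP sepL bP; rewrite /sobolev_normsq EFinM.
have P0 : 0 < P by exact: lt_le_trans P1.
have c0 : 0 <= (2 * pi) ^- n :> R by rewrite invr_ge0 exprn_ge0// mulr_ge0// pi_ge0.
apply: lee_wpmul2l; first by rewrite lee_fin.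
have d0 : 0 <= 2 * (P ^+ 2) `^ r by rewrite mulr_ge0// powR_ge0.
rewrite -(@int_Rn_e_prod R n (fun i => wave_majorant (s i) (a i) L B (K i))) //; last 3 first.
- by move=> i x; exact: wave_majorant_ge0.
- by move=> i; exact: measurable_wave_majorant.
- by move=> i; exact: integral_wave_majorant.
apply: le_int_Rn_e => xi.
  by rewrite lee_fin mulr_ge0 ?powR_ge0// sqr_ge0.
rewrite lee_fin fourier_product_wave cabsR real_normK ?num_real//.
have N0 : 0 <= normsq xi by exact: normsq_ge0.
have P20 : 0 < P ^+ 2 by rewrite exprn_gt0.
have y0 : 0 <= (1 + normsq xi) / P ^+ 2 by rewrite divr_ge0 ?addr_ge0// ltW.
have h1 : (1 + normsq xi) `^ r <= (P ^+ 2) `^ r * (1 + (1 + normsq xi) / P ^+ 2).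
  rewrite [in leLHS](_ : 1 + normsq xi = P ^+ 2 * ((1 + normsq xi) / P ^+ 2)); last first.
    by rewrite mulrC divfK// lt0r_neq0.
  rewrite powRM//; last exact: ltW.
  by rewrite ler_wpM2l ?powR_ge0// powR_le1D.
have h2 : 1 + (1 + normsq xi) / P ^+ 2 <= 2 * \prod_(i < n) (1 + xi 0 i ^+ 2 / P ^+ 2).
  have h : 1 + \sum_(i < n) xi 0 i ^+ 2 / P ^+ 2 <= \prod_(i < n) (1 + xi 0 i ^+ 2 / P ^+ 2).
    by apply: ler1D_sum_prod => i; rewrite divr_ge0 ?sqr_ge0.
  have h3 : (P ^+ 2)^-1 <= 1 by rewrite invf_le1// expr_ge1// ltW.
  have h4 : normsq xi / P ^+ 2 = \sum_(i < n) xi 0 i ^+ 2 / P ^+ 2.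
    by rewrite /normsq /dotR mulr_suml; apply: eq_bigr => i _; rewrite expr2.
  have h5 : 0 <= normsq xi / P ^+ 2 by rewrite divr_ge0// ltW.
  by move: h; rewrite mulrDl mul1r -h4; lra.
have W0 : 0 <= \prod_(i < n) wave_hat (s i) (b i) (K i) (xi 0 i) ^+ 2.
  by apply: prodr_ge0 => i _; exact: sqr_ge0.
rewrite -prodrXl (le_trans (ler_wpM2r W0 h1))//.
rewrite (le_trans (ler_wpM2r W0 (ler_wpM2l (powR_ge0 _ _) h2)))//.
rewrite mulrA -mulrA (mulrC _ 2) ler_wpM2l// -big_split/=.
apply: ler_prod => i _; apply/andP; split.
  by rewrite mulr_ge0 ?sqr_ge0// addr_ge0// divr_ge0 ?sqr_ge0.
exact: wave_hat_weight (s0 i) (sP i) (sepL i) (bP i) _.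
Qed.

End product_wave.

(** The cube [[d, 2d]^n] lies in the ball and has volume [d^n]. It stays away from the origin, which
    later keeps the chosen times positive. *)
Lemma L1_unit_ball_ge (R : realType) n (F : 'rV[R]_n -> \bar R) (d M : R) :
  0 < d -> 0 <= M -> n%:R * (2 * d) ^+ 2 < 1 -> (forall x, 0 <= F x)%E ->
  (forall x : 'rV[R]_n, (forall i, d <= x 0 i <= 2 * d) -> (M%:E <= F x)%E) ->
  ((M * d ^+ n)%:E <= L1_unit_ball F)%E.
Proof.
move=> d0 M0 nd F0 hF.
have -> : M * d ^+ n = M * \prod_(i < n) (fun=> d) i.
  by rewrite prodr_const card_ord.
pose I : set R := [set` `[d, 2 * d]].
have mI : measurable I by exact: measurable_itv.
rewrite -(@int_Rn_e_prod R n (fun i => \1_I) (fun=> d))//; last first.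
- move=> i; rewrite integral_indic// setIT; apply: etrans (lebesgue_measure_itv _) _.
  by rewrite /= lte_fin ltr_pMl// ltr1n/= -EFinD; congr EFin; ring.
apply: le_int_Rn_e => x.
  by rewrite lee_fin mulr_ge0// prodr_ge0.
case: (pselect (forall i, d <= x 0 i <= 2 * d)) => hx.
  rewrite ifT.
    rewrite big1 ?mulr1; first exact: hF.
    by move=> i _; rewrite indicE mem_set// /I/= in_itv/=.
  apply/asboolP; apply: le_lt_trans nd.
  rewrite /normsq /dotR mulr_natl -[X in _ *+ X]card_ord -sumr_const.
  apply: ler_sum => i _; have /andP[h1 h2] := hx i.
  rewrite expr2 ler_pM// (le_trans _ h1)// ltW//.
have [i hi] : exists i, ~ (d <= x 0 i <= 2 * d) by apply/existsNP.
rewrite (bigD1 i)//= indicE memNset ?mul0r ?mulr0.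
  by case: ifP.
by rewrite /I/= in_itv/=.
Qed.

(** * The choice of parameters *)

(* The integers [m] of the statement form a class modulo [Q^d], whose base-[Q]
   digits are determined successively from the [y j]. *)
Lemma digits_window (R : realType) (d Q : nat) (y : nat -> R) (x : R) : (0 < Q)%N ->
  exists m : int, x - Q%:R ^+ d < m%:~R <= x /\
    forall j, (j < d)%N -> exists z : int,
      0 <= y j + m%:~R / Q%:R ^+ j.+1 - z%:~R < Q%:R^-1.
Proof.
move=> Q0.
have q0 : (0 : R) < Q%:R by rewrite ltr0n.
have [r hr] : exists r : int, forall (e : int) j, (j < d)%N -> exists z : int,
    0 <= y j + (r + Q%:Z ^+ d * e)%:~R / Q%:R ^+ j.+1 - z%:~R < Q%:R^-1.
  elim: d => [|d [r hr]]; first by exists 0.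
  (* Adding [Q^d * e0] changes the earlier quantities by integers and [w] by [e0 / Q]; this [e0]
     brings [w] into [[0, 1/Q)]. *)
  pose w := y d + r%:~R / Q%:R ^+ d.+1.
  pose e0 := - Num.floor (Q%:R * w).
  exists (r + Q%:Z ^+ d * e0) => e j; rewrite ltnS leq_eqVlt => /predU1P[->|jd].
    exists e.
    have -> : y d + (r + Q%:Z ^+ d * e0 + Q%:Z ^+ d.+1 * e)%:~R / Q%:R ^+ d.+1 - e%:~R =
        (Q%:R * w - (Num.floor (Q%:R * w))%:~R) / Q%:R.
      rewrite /e0; set F := Num.floor _; rewrite /w exprS.
      rewrite !(intrD, intrM, rmorphXn, intrN, exprS) /=.
      rewrite (_ : Q%:~R = Q%:R :> R)//.
      by field; rewrite expf_neq0 lt0r_neq0.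
    rewrite divr_ge0 ?subr_ge0 ?floor_le ?(ltW q0)//=.
    rewrite ltr_pdivrMr// mulVf ?lt0r_neq0// ltrBlDl.
    by have := floorD1_gt (Q%:R * w); rewrite intrD.
  have [z hz] := hr (e0 + Q%:Z * e) j jd; exists z.
  by rewrite (_ : _ + _ = r + Q%:Z ^+ d * (e0 + Q%:Z * e))// exprSr; ring.
(* The representative of the class modulo [Q^d] that falls in the window ending at [x]. *)
pose e := Num.floor ((x - r%:~R) / Q%:R ^+ d).
have Qd0 : (0 : R) < Q%:R ^+ d by rewrite exprn_gt0.
exists (r + Q%:Z ^+ d * e); split; last exact: hr.
have h1 : e%:~R <= (x - r%:~R) / Q%:R ^+ d by exact: floor_le.
have h2 : (x - r%:~R) / Q%:R ^+ d < e%:~R + 1.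
  by have := floorD1_gt ((x - r%:~R) / Q%:R ^+ d); rewrite intrD.
rewrite ler_pdivlMr// in h1; rewrite ltr_pdivrMr// in h2.
rewrite intrD intrM rmorphXn /= (_ : Q%:~R = Q%:R :> R)//.
by move: h1 h2; rewrite mulrDl mul1r mulrC; lra.
Qed.

Section bourgain_example.
Variables (R : realType) (d A B N : nat).
Let c : R := 1 / 28.
Hypotheses (A0 : (0 < A)%N) (B0 : (0 < B)%N) (NA : (168 * A < N)%N).
Hypothesis hB : 2 * pi / B%:R <= c.
Hypothesis hA : 4 * pi * B%:R ^+ d / A%:R <= c.

(* [(bourgain_s i)^-1] is the width of the Gaussian, [bourgain_K] the number of
   frequencies and [bourgain_a] the frequency shift in each variable;
   [B * N] is the base [Q] of the digit expansion. *)
Definition bourgain_P : R := N%:R ^+ (2 * d.+2).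
Definition bourgain_L : R := A%:R * N%:R ^+ (2 * d).+3.
Definition bourgain_s (i : 'I_d.+1) : R := if i == ord0 then N%:R ^+ d.+2 else 1.
Definition bourgain_K (i : 'I_d.+1) : nat := if i == ord0 then 1%N else N.
Definition bourgain_a (i : 'I_d.+1) : R :=
  if i == ord0 then - bourgain_P else bourgain_L / (2 * (B * N)%:R ^+ i).
(** Divided by [A] because the frequencies reach [A * P] while [P * t <= bourgain_delta]: the
    displacement [x_i + 2 b_k t] is then at most [4 * A * bourgain_delta < c]. *)
Definition bourgain_delta : R := c / (6 * A%:R).
Let b i (k : nat) := bourgain_a i + bourgain_L * k%:R.

Lemma bourgain_evol_ge (x : 'rV[R]_d.+1) :
  (forall i, bourgain_delta <= x 0 i <= 2 * bourgain_delta) ->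
  exists2 t : R, 0 < t < 1 & forall i,
    (bourgain_K i)%:R * pi <= cabs (wave_evol (bourgain_s i) (b i) (bourgain_K i) t (x 0 i)).
Proof.
move=> hx.
have c0 : 0 < c by rewrite divr_gt0.
have A1 : (1 : R) <= A%:R by rewrite ler1n.
have a0 : (0 : R) < A%:R by rewrite ltr0n.
have b0 : (0 : R) < B%:R by rewrite ltr0n.
have N0 : (0 < N)%N by rewrite (leq_ltn_trans _ NA).
have n0 : (0 : R) < N%:R by rewrite ltr0n.
have N1 : (1 : R) <= N%:R by rewrite ler1n.
have p0 : (0 : R) < pi by exact: pi_gt0.
pose u : R := N%:R ^+ d.
have u0 : 0 < u by rewrite exprn_gt0.
have u1 : 1 <= u by rewrite exprn_ege1.
have PE : bourgain_P = u ^+ 2 * N%:R ^+ 4.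
  by rewrite /bourgain_P /u -exprM -exprD; congr (_ ^+ _); clear; lia.
have LE : bourgain_L = A%:R * (u ^+ 2 * N%:R ^+ 3).
  by rewrite /bourgain_L /u -exprM -exprD; congr (_ * _ ^+ _); clear; lia.
have s0E : N%:R ^+ d.+2 = u * N%:R ^+ 2 :> R.
  by rewrite /u -exprD; congr (_ ^+ _); clear; lia.
have P0 : 0 < bourgain_P by rewrite /bourgain_P exprn_gt0.
have P1 : 1 <= bourgain_P by rewrite /bourgain_P exprn_ege1.
have L0 : 0 < bourgain_L by rewrite /bourgain_L mulr_gt0// exprn_gt0.
have dl0 : 0 < bourgain_delta by rewrite /bourgain_delta divr_gt0// mulr_gt0.
have Q0 : (0 < B * N)%N by rewrite muln_gt0 B0.
(* The window ends at the [m] for which [2 P t = x_0] when [t = 2 pi m / L^2]; [y j] is the phase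
   increment between consecutive frequencies in the variable [j.+1], in units of [2 pi]. *)
have [m [/andP[m1 m2] hm]] := @digits_window R d (B * N)%N
  (fun j => bourgain_L * x 0 (inord j.+1) / (2 * pi))
  (x 0 ord0 * bourgain_L ^+ 2 / (4 * pi * bourgain_P)) Q0.
set M : R := m%:~R in m1 m2 hm.
pose t : R := 2 * pi * M / bourgain_L ^+ 2.
have L2 : 0 < bourgain_L ^+ 2 by rewrite exprn_gt0.
have pP : 0 < 4 * pi * bourgain_P by rewrite mulr_gt0// mulr_gt0.
have tP : 2 * bourgain_P * t <= x 0 ord0.
  move: m2; rewrite ler_pdivlMr// => m2.
  rewrite /t (_ : _ * _ = M * (4 * pi * bourgain_P) / bourgain_L ^+ 2) ?ler_pdivrMr//.
  by field; exact: lt0r_neq0.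
(* The length [Q^d] of the window for [m] becomes a distance [4 pi P Q^d / L^2]; times the scale
   [N^(d+2)] all powers of [N] cancel, leaving [4 pi B^d / A^2]. *)
have tP2 : N%:R ^+ d.+2 * (x 0 ord0 - 2 * bourgain_P * t) <= c.
  apply: (@le_trans _ _ (4 * pi * B%:R ^+ d / A%:R ^+ 2)); last first.
    apply: le_trans hA; rewrite ler_wpM2l//.
      by rewrite mulr_ge0 ?exprn_ge0 ?mulr_ge0// ltW.
    by rewrite lef_pV2 ?posrE ?exprn_gt0// expr2 ler_peMl// ltW.
  apply: (@le_trans _ _ (N%:R ^+ d.+2 *
      ((B * N)%:R ^+ d * (4 * pi * bourgain_P) / bourgain_L ^+ 2))).
    apply: ler_wpM2l; first by rewrite exprn_ge0// ltW.
    move/ltW: m1; rewrite lerBlDr ler_pdivrMr// => m1.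
    rewrite /t (_ : 2 * bourgain_P * _ = M * (4 * pi * bourgain_P) / bourgain_L ^+ 2);
      last by field; exact: lt0r_neq0.
    rewrite lerBlDr -mulrDl ler_pdivlMr//.
    by move: m1; rewrite mulrDl addrC.
  rewrite natrM exprMn -/u s0E PE LE le_eqVlt; apply/orP; left; apply/eqP.
  by field; rewrite !lt0r_neq0.
(* The distance from [2 P t] to [x_0] is at most [c / N], which is less than
   [bourgain_delta <= x_0]. *)
have t0 : 0 < t.
  suff : 0 < 2 * bourgain_P * t by rewrite pmulr_rgt0// mulr_gt0.
  have /andP[x1 _] := hx ord0.
  have s1 : N%:R <= N%:R ^+ d.+2 :> R.
    by rewrite exprS ler_peMr ?exprn_ege1// ltW.
  have h : x 0 ord0 - 2 * bourgain_P * t <= c / N%:R.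
    rewrite ler_pdivlMr//; have [y0|y0] := leP 0 (x 0 ord0 - 2 * bourgain_P * t).
      by apply: le_trans tP2; rewrite mulrC ler_wpM2r.
    by move: tP y0; rewrite -subr_ge0; lra.
  have h2 : c / N%:R < bourgain_delta.
    rewrite /bourgain_delta ltr_pM2l// ltf_pV2 ?posrE ?mulr_gt0//.
    by rewrite -natrM ltr_nat (leq_ltn_trans _ NA)// leq_mul2r orbT.
  lra.
have /andP[x1 x2] := hx ord0.
have dlE : 6 * A%:R * bourgain_delta = c.
  by rewrite /bourgain_delta mulrC divfK// mulf_neq0 ?lt0r_neq0.
have dlc : 6 * bourgain_delta <= c.
  by rewrite -dlE mulrAC ler_peMr// mulr_ge0// ltW.
have Ptle : bourgain_P * t <= bourgain_delta by move: tP x2; lra.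
have tle : t <= bourgain_delta.
  by apply: le_trans Ptle; rewrite ler_peMl// ltW.
have cE : c = 1/28 by [].
exists t; first by rewrite t0/=; lra.
(* In the first variable there is a single frequency, so no alignment is at stake; the squared scale
   is exactly [P]. *)
move=> i; have [i0|i0] := eqVneq i ord0.
  have b0E : b i 0 = - bourgain_P by rewrite /b /bourgain_a i0 eqxx mulr0 addr0.
  apply: (@wave_evol_ge _ _ _ _ _ _ _ (b i 0 * x 0 i + b i 0 ^+ 2 * t) (fun=> 0)).
  - by rewrite /bourgain_s i0 eqxx exprn_gt0.
  - by rewrite /bourgain_K i0 eqxx => -[|]// _; rewrite expi0 mulr1.
  - by move=> k _; rewrite normr0.
  - rewrite {1}/bourgain_K {1}i0 eqxx => -[|]// _.
    rewrite b0E /bourgain_s i0 eqxx.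
    rewrite (_ : x 0 ord0 + _ = x 0 ord0 - 2 * bourgain_P * t); last by ring.
    by rewrite ger0_norm// mulr_ge0 ?subr_ge0// exprn_ge0// ltW.
  - rewrite /bourgain_s i0 eqxx -exprM mulnC -/bourgain_P ger0_norm;
      last by rewrite mulr_ge0// ltW.
    by lra.
have iE : bourgain_a i = bourgain_L / (2 * (B * N)%:R ^+ i) by rewrite /bourgain_a (negbTE i0).
have KE : bourgain_K i = N by rewrite /bourgain_K (negbTE i0).
have sE : bourgain_s i = 1 by rewrite /bourgain_s (negbTE i0).
have i_gt0 : (0 < i)%N by rewrite lt0n; apply: contra i0 => /eqP e; apply/eqP/val_inj.
have [|z] := hm i.-1; first by rewrite -ltnS (prednK i_gt0).
rewrite (prednK i_gt0) inord_val.
set q : R := (B * N)%:R ^+ i; set rho : R := _ - _ => /andP[rho0 rho1].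
have Qr0 : (0 : R) < (B * N)%:R by rewrite ltr0n.
have q0 : 0 < q by rewrite exprn_gt0.
have q1 : 1 <= q by rewrite exprn_ege1// ler1n.
have kN k : (k < N)%N -> (k%:R : R) <= N%:R by move=> kN; rewrite ler_nat ltnW.
have bE k : b i k = bourgain_L / (2 * q) + bourgain_L * k%:R by rewrite /b iE.
apply: (@wave_evol_ge _ _ _ _ _ _ _ (bourgain_a i * x 0 i + bourgain_a i ^+ 2 * t)
  (fun k => 2 * pi * rho * k%:R)).
- by rewrite sE.
- move=> k _.
  (* Here [L^2 t = 2 pi m] and [2 a_i L t = 2 pi m / q], so the part depending on [k] is [2 pi k (L
     x_i / (2 pi) + m / q) + 2 pi k^2 m], and the bracket is [rho + z]. *)
  rewrite (_ : b i k * x 0 i + b i k ^+ 2 * t = (bourgain_a i * x 0 i + bourgain_a i ^+ 2 * t) +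
    2 * pi * rho * k%:R + 2 * pi * (k%:Z * z + k%:Z ^+ 2 * m)%:~R).
    by rewrite !expiD expi_int mulr1.
  rewrite bE iE -/q /t /rho !(intrD, intrM, rmorphXn) /= -/M (_ : k%:~R = k%:R :> R)//.
  by move: p0; move: (pi : R) => p p0; field; rewrite !lt0r_neq0.
- move=> k; rewrite KE => /kN kN'.
  rewrite ger0_norm; last by rewrite !mulr_ge0// ltW.
  apply: le_trans hB; rewrite -!mulrA ler_wpM2l// ler_wpM2l ?(ltW p0)//.
  (* [rho] is below [1 / (B N)] and [k] below [N], so the phase errors stay below [2 pi / B]. *)
  apply: (@le_trans _ _ ((B * N)%:R^-1 * N%:R)); first by apply: ler_pM => //; exact: ltW.
  by rewrite natrM invfM -mulrA mulVf ?mulr1// lt0r_neq0.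
- move=> k; rewrite KE => kltN; have kN1 : (k%:R : R) + 1 <= N%:R by rewrite natr1 ler_nat.
  have b1 : 0 <= b i k.
    rewrite bE; apply: addr_ge0; last by apply: mulr_ge0; [exact: ltW|exact: ler0n].
    by apply: divr_ge0; [exact: ltW|apply: mulr_ge0; [exact: ler0n|exact: ltW]].
  have b2 : b i k <= A%:R * bourgain_P.
    have h1 : bourgain_L / (2 * q) <= bourgain_L.
      by rewrite ler_pdivrMr ?mulr_gt0// ler_peMr ?(ltW L0)//; lra.
    have h2 : bourgain_L * (k%:R + 1) <= bourgain_L * N%:R by rewrite ler_wpM2l// ltW.
    have -> : A%:R * bourgain_P = bourgain_L * N%:R by rewrite LE PE; ring.
    by rewrite bE; move: h1 h2; rewrite mulrDr mulr1; lra.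
  have bt : b i k * t <= A%:R * bourgain_P * t by rewrite ler_wpM2r// ltW.
  have Apt : A%:R * (bourgain_P * t) <= A%:R * bourgain_delta by rewrite ler_wpM2l// ltW.
  have /andP[xi1 xi2] := hx i.
  have dA : bourgain_delta <= A%:R * bourgain_delta by rewrite ler_peMl// ltW.
  have bt0 : 0 <= b i k * t by rewrite mulr_ge0// ltW.
  rewrite sE mul1r ger0_norm; last by rewrite -mulrA; lra.
  by move: bt Apt dA dlE; rewrite -cE -!mulrA; lra.
- by rewrite sE expr1n mul1r gtr0_norm//; lra.
Qed.

End bourgain_example.

Lemma powR_unbounded (R : realType) (e k : R) (m : nat) : 0 < e ->
  exists2 N : nat, (m < N)%N & k < N%:R `^ e.
Proof.
move=> e0; pose y := (`|k| + 1) `^ e^-1.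
have y0 : 0 <= y by exact: powR_ge0.
exists (Num.bound y + m.+1)%N; first by rewrite addnC leq_addr.
have k1 : 0 <= `|k| + 1 by rewrite addr_ge0.
have : k < y `^ e.
  rewrite /y -powRrM mulVf ?lt0r_neq0// powRr1//.
  by rewrite (le_lt_trans (ler_norm k))// ltrDl.
move=> /lt_le_trans; apply; apply: ge0_ler_powR; rewrite ?nnegrE//; first exact: ltW.
by rewrite natrD ler_wpDr// ltW// archi_boundP.
Qed.


(** * Sizes of the maximal function and of the Sobolev norm for the example *)

Section bourgain_norms.
Variables (R : realType) (d A B N : nat) (r : R).
Hypotheses (A0 : (0 < A)%N) (B0 : (0 < B)%N) (NA : (168 * A < N)%N).
Hypothesis r01 : 0 <= r <= 1.
Local Notation n := d.+1.
Local Notation f := (product_wave (@bourgain_s R d N) (@bourgain_a R d A B N)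
  (bourgain_L R d A N) (@bourgain_K d N)).
Local Notation dl := (bourgain_delta R A).

Let N0 : (0 < N)%N. Proof. by rewrite (leq_ltn_trans _ NA). Qed.
Let N1 : (1 : R) <= N%:R. Proof. by rewrite ler1n. Qed.

Lemma bourgain_prodK : \prod_(i < n) (@bourgain_K d N i)%:R = N%:R ^+ d :> R.
Proof.
rewrite big_ord_recl /bourgain_K eqxx mul1r (eq_bigr (fun=> N%:R)) ?prodr_const ?card_ord//.
Qed.

Lemma bourgain_s_ge1 i : 1 <= @bourgain_s R d N i.
Proof. by rewrite /bourgain_s; case: eqP => // _; rewrite exprn_ege1. Qed.

Lemma bourgain_prods : \prod_(i < n) @bourgain_s R d N i = N%:R ^+ d.+2.
Proof.
rewrite big_ord_recl /bourgain_s eqxx big1 ?mulr1//.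
Qed.

Lemma bourgain_schwartz : schwartz f.
Proof. exact: schwartz_product_wave bourgain_s_ge1. Qed.

Lemma bourgain_delta_gt0 : 0 < dl.
Proof. by rewrite /bourgain_delta divr_gt0 ?divr_gt0 ?mulr_gt0 ?ltr0n. Qed.

Lemma bourgain_L1_ge : 2 * pi / B%:R <= 1/28 :> R ->
  4 * pi * B%:R ^+ d / A%:R <= 1/28 :> R -> n%:R * (2 * dl) ^+ 2 < 1 ->
  (((2 * pi) ^- n * (N%:R ^+ d * pi ^+ n) * dl ^+ n)%:E <=
    L1_unit_ball (max_schrodinger f))%E.
Proof.
move=> hB hA nd; apply: L1_unit_ball_ge => //.
- exact: bourgain_delta_gt0.
- by rewrite !mulr_ge0 ?invr_ge0 ?exprn_ge0 ?mulr_ge0 ?pi_ge0.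
(* Nonnegativity of the supremum, tested at an arbitrary time of the interval. *)
- move=> x; apply: (@le_trans _ _ (cabs (schrodinger (1/2) f x))%:E).
    by rewrite lee_fin cabs_ge0.
  by apply: ereal_sup_ubound; exists (1/2) => //=; rewrite in_itv/=; lra.
- move=> x hx; have [t t01 ht] := bourgain_evol_ge A0 B0 NA hB hA hx.
  apply: (@le_trans _ _ (cabs (schrodinger t f x))%:E); last first.
    by apply: ereal_sup_ubound; exists t.
  rewrite lee_fin schrodinger_product_wave; last exact: bourgain_s_ge1.
  have c0 : 0 <= (2 * pi) ^- n :> R by rewrite invr_ge0 exprn_ge0// mulr_ge0// pi_ge0.
  rewrite cabsM cabsR ger0_norm// ler_wpM2l// cabs_prod.
  rewrite -bourgain_prodK -[X in pi ^+ X]card_ord -prodr_const -big_split/=.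
  by apply: ler_prod => i _; rewrite mulr_ge0 ?pi_ge0//=.
Qed.

(** The constant of [integral_wave_majorant] when all frequencies are at most [2 * A * P] in
    modulus. *)
Definition bourgain_const : R := 18 * pi * (13 + 2 * (2 * A%:R) ^+ 2) * Num.sqrt (2 * pi).

Lemma bourgain_sobolev_le : sobolev_norm r f <= Num.sqrt ((2 * pi) ^- n *
  (2 * (N%:R ^+ (4 * d.+2)) `^ r * (bourgain_const ^+ n * (N%:R ^+ d / N%:R ^+ d.+2)))).
Proof.
have n0 : (0 : R) < N%:R by rewrite ltr0n.
have A1 : (1 : R) <= A%:R by rewrite ler1n.
have a0 : (0 : R) < A%:R by rewrite ltr0n.
have P0 : 0 < bourgain_P R d N by rewrite /bourgain_P exprn_gt0.
have P1 : 1 <= bourgain_P R d N by rewrite /bourgain_P exprn_ege1.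
have L0 : 0 < bourgain_L R d A N by rewrite /bourgain_L mulr_gt0// exprn_gt0.
have LN : bourgain_L R d A N * N%:R = A%:R * bourgain_P R d N.
  by rewrite /bourgain_L /bourgain_P -mulrA -exprSr; congr (_ * _ ^+ _); clear; lia.
have sP i : @bourgain_s R d N i <= bourgain_P R d N.
  rewrite /bourgain_s /bourgain_P; case: eqP => _; last by rewrite exprn_ege1.
  by rewrite ler_weXn2l//; clear; lia.
have sL i : (@bourgain_K d N i)%:R * @bourgain_s R d N i ^+ 2 <= bourgain_L R d A N ^+ 2.
  apply: (@le_trans _ _ ((N%:R ^+ (2 * d).+3) ^+ 2)); last first.
    rewrite ler_sqr ?nnegrE ?exprn_ge0 ?(ltW n0) ?(ltW L0)//.
    by rewrite /bourgain_L ler_peMl// exprn_ge0// ltW.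
  rewrite /bourgain_K /bourgain_s; case: eqP => _.
    by rewrite mul1r -!exprM ler_weXn2l//; clear; lia.
  by rewrite expr1n mulr1 -exprM -[leLHS]expr1 ler_weXn2l//; clear; lia.
have bP i k : (k < @bourgain_K d N i)%N ->
    `|@bourgain_a R d A B N i + bourgain_L R d A N * k%:R| <= (2 * A%:R) * bourgain_P R d N.
  rewrite /bourgain_K /bourgain_a; case: eqP => [_|_].
    case: k => // _; rewrite mulr0 addr0 normrN gtr0_norm//.
    by rewrite ler_peMl ?(ltW P0)//; lra.
  move=> kN; have kN' : (k%:R : R) <= N%:R by rewrite ler_nat ltnW.
  set q : R := (B * N)%:R ^+ i.
  have q1 : 1 <= q by rewrite exprn_ege1// ler1n muln_gt0 B0.
  have q0 : 0 < q by exact: lt_le_trans q1.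
  have h0 : 0 <= bourgain_L R d A N / (2 * q).
    by apply: divr_ge0; [exact: ltW|apply: mulr_ge0; [exact: ler0n|exact: ltW]].
  have h1 : bourgain_L R d A N / (2 * q) <= bourgain_L R d A N.
    by rewrite ler_pdivrMr ?mulr_gt0// ler_peMr ?(ltW L0)//; lra.
  have h2 : bourgain_L R d A N <= bourgain_L R d A N * N%:R by rewrite ler_peMr// ltW.
  have h3 : bourgain_L R d A N * k%:R <= bourgain_L R d A N * N%:R by rewrite ler_wpM2l// ltW.
  have h4 : 0 <= bourgain_L R d A N * k%:R by apply: mulr_ge0; [exact: ltW|exact: ler0n].
  rewrite ger0_norm; last exact: addr_ge0.
  by rewrite -mulrA -LN; lra.
have := sobolev_product_wave (a := @bourgain_a R d A B N) bourgain_s_ge1 P1 r01 sP sL bP.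
rewrite big_split/= prodr_const card_ord big_split/= prodfV bourgain_prodK bourgain_prods.
rewrite -/bourgain_const {1}/bourgain_P -exprM (_ : (2 * d.+2 * 2)%N = (4 * d.+2)%N);
  last by clear; lia.
rewrite /sobolev_norm.
set Y := sobolev_normsq _ _; set X := _ * _ => YX.
rewrite ler_wsqrtr//.
(* [fine] sends infinities to 0; [Y] lies between 0 and a real number, so the bound passes through
   it. *)
have : (0 <= Y)%E.
  rewrite /Y /sobolev_normsq mule_ge0//.
    by rewrite lee_fin invr_ge0 exprn_ge0// mulr_ge0// pi_ge0.
  by apply: int_Rn_e_ge0 => v; rewrite lee_fin mulr_ge0 ?powR_ge0// sqr_ge0.
by move: YX; case: Y => [y| |] //=; rewrite lee_fin.
Qed.

End bourgain_norms.

(** * Comparison of the powers of [N] *)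

Lemma bourgain_delta_small (R : realType) (A n : nat) : (0 < n)%N -> (n <= A)%N ->
  n%:R * (2 * bourgain_delta R A) ^+ 2 < 1.
Proof.
move=> n0 nA.
have A1 : (1 : R) <= A%:R by rewrite ler1n (leq_trans n0).
have a0 : (0 : R) < A%:R by exact: lt_le_trans A1.
have dA : A%:R * bourgain_delta R A = 1/168.
  by rewrite /bourgain_delta; field; exact: lt0r_neq0.
have d0 : 0 < bourgain_delta R A by rewrite /bourgain_delta divr_gt0 ?divr_gt0 ?mulr_gt0.
have nA2 : n%:R <= A%:R ^+ 2 :> R.
  by rewrite -natrX ler_nat (leq_trans nA)// expnS leq_pmulr// expn1 (leq_trans n0).
apply: (@le_lt_trans _ _ (A%:R ^+ 2 * (2 * bourgain_delta R A) ^+ 2)).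
  by rewrite ler_wpM2r// sqr_ge0.
by rewrite -exprMn mulrCA dA; lra.
Qed.

Theorem theorem2 (R : realType) (n : nat) (s : R) :
  (2 <= n)%N -> 0 < s ->
  (exists C_s : R, forall f : 'rV[R]_n -> R[i], schwartz f ->
     (L1_unit_ball (max_schrodinger f) <= (C_s * sobolev_norm s f)%:E)%E) ->
  n%:R / (2 * n.+1%:R) <= s.
Proof.
case: n => // d _ s0 [C hC].
rewrite leNgt; apply/negP => hs.
have pi0 : (0 : R) < pi by exact: pi_gt0.
(* The assumed failure forces [s] below 1, the range of [powR_le1D]. *)
have r01 : 0 <= s <= 1.
  rewrite (ltW s0)/= (le_trans (ltW hs))// ler_pdivrMr ?mulr_gt0// mul1r.
  by rewrite -natrM ler_nat; clear; lia.
(* The gap between the exponents of [N] on the two sides of [key], positive exactly when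
   [s < (d + 1) / (2 (d + 2))]. *)
pose e : R := (2 * d).+2%:R - (4 * d.+2)%:R * s.
have e0 : 0 < e.
  move: hs; rewrite ltr_pdivlMr ?mulr_gt0// => hs.
  rewrite /e subr_gt0 natrM (_ : (2 * d).+2 = (2 * d.+1)%N); last by clear; lia.
  by rewrite natrM; move: hs; rewrite mulrC; lra.
(* The order of choice matters: [A] depends on [B^d], and [N] is taken last, beyond a bound
   depending on both. *)
have [B B0 hB] : exists2 B : nat, (0 < B)%N & 2 * pi / B%:R <= 1/28 :> R.
  exists (Num.bound (56 * pi : R)).+1 => //.
  rewrite ler_pdivrMr// -natr1.
  by have := @archi_boundP R (56 * pi); rewrite mulr_ge0 ?(ltW pi0)// => /(_ isT); lra.
have [A [nA A0 hA]] : exists A : nat, [/\ (d.+1 <= A)%N, (0 < A)%N &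
    4 * pi * B%:R ^+ d / A%:R <= 1/28 :> R].
  have h0 : 0 <= 112 * pi * B%:R ^+ d :> R by rewrite !mulr_ge0 ?exprn_ge0// ltW.
  exists (Num.bound (112 * pi * B%:R ^+ d : R) + d.+1)%N; split.
  - exact: leq_addl.
  - by rewrite addnS.
  - rewrite ler_pdivrMr ?ltr0n ?addnS// -addnS natrD.
    have := archi_boundP h0; have : (0 : R) <= d.+1%:R by []; lra.
pose q : R := (2 * pi) ^- d.+1.
have q0 : 0 < q by rewrite invr_gt0 exprn_gt0// mulr_gt0.
have dl0 := bourgain_delta_gt0 R A0.
pose k1 : R := q * pi ^+ d.+1 * bourgain_delta R A ^+ d.+1.
have k10 : 0 < k1 by rewrite !mulr_gt0 ?exprn_gt0.
pose k2 : R := C ^+ 2 * (q * (2 * bourgain_const R A ^+ d.+1)).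
have [N NA hN] := powR_unbounded (k2 / k1 ^+ 2) (168 * A) e0.
have N0 : (0 < N)%N by rewrite (leq_ltn_trans _ NA).
have n0 : (0 : R) < N%:R by rewrite ltr0n.
have fS := bourgain_schwartz R d B NA.
have nd := bourgain_delta_small R (ltn0Sn d) nA.
have lo := bourgain_L1_ge A0 B0 NA hB hA nd.
have up := bourgain_sobolev_le d A0 B0 NA r01.
have := le_trans lo (hC _ fS); rewrite lee_fin => main.
set S := sobolev_norm s _ in up main.
set X := (X in Num.sqrt X) in up.
have c0 : 0 <= bourgain_const R A.
  apply: mulr_ge0; last exact: sqrtr_ge0.
  apply: mulr_ge0; first by rewrite mulr_ge0// ltW.
  by rewrite addr_ge0// pmulr_rge0// sqr_ge0.
have X0 : 0 <= X.
  apply: mulr_ge0; first exact: ltW.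
  apply: mulr_ge0; first by rewrite pmulr_rge0// powR_ge0.
  by rewrite mulr_ge0 ?divr_ge0 ?exprn_ge0.
have S0 : 0 <= S by exact: sqrtr_ge0.
have sq : (k1 * N%:R ^+ d) ^+ 2 <= C ^+ 2 * X.
  (* [C] may be negative, so it is replaced by its absolute value before squaring. *)
  have h1 : k1 * N%:R ^+ d <= `|C| * S.
    rewrite (_ : k1 * _ = q * (N%:R ^+ d * pi ^+ d.+1) * bourgain_delta R A ^+ d.+1).
      by rewrite (le_trans main)// ler_wpM2r// ler_norm.
    by rewrite /k1; ring.
  have h2 : 0 <= k1 * N%:R ^+ d by rewrite mulr_ge0 ?exprn_ge0// ltW.
  rewrite (le_trans (_ : _ <= (`|C| * S) ^+ 2))//.
    by rewrite ler_sqr ?nnegrE// mulr_ge0.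
  rewrite exprMn real_normK ?num_real// ler_wpM2l ?sqr_ge0//.
  by rewrite -(sqr_sqrtr X0) ler_sqr ?nnegrE ?sqrtr_ge0.
(* The [N^(2d)] of the squared lower bound meets the [N^d / N^(d+2)] of the Sobolev norm, which
   gives the exponent [2 d + 2]. *)
have key : N%:R ^+ (2 * d).+2 <= k2 / k1 ^+ 2 * (N%:R ^+ (4 * d.+2)) `^ s.
  rewrite mulrAC ler_pdivlMr ?exprn_gt0//.
  have u0 : 0 < N%:R ^+ d / N%:R ^+ d.+2 :> R by rewrite divr_gt0 ?exprn_gt0.
  rewrite -(ler_pM2r u0).
  have -> : N%:R ^+ (2 * d).+2 * k1 ^+ 2 * (N%:R ^+ d / N%:R ^+ d.+2) = (k1 * N%:R ^+ d) ^+ 2.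
    rewrite (_ : (2 * d).+2 = (d + d.+2)%N); last by rewrite mul2n -addnn !addnS.
    by rewrite exprD; field; rewrite expf_neq0// lt0r_neq0.
  by apply: le_trans sq _; rewrite /X /k2 -/q le_eqVlt; apply/orP; left; apply/eqP; ring.
(* By this factorization [key] would bound [N^e] by [k2 / k1^2], against the choice of [N]. *)
have NE : N%:R ^+ (2 * d).+2 = N%:R `^ e * (N%:R ^+ (4 * d.+2)) `^ s :> R.
  rewrite -!powR_mulrn ?ler0n// -powRrM -powRD; last by rewrite (lt0r_neq0 n0) implybT.
  by rewrite /e subrK.
have := ltr_pM2r (powR_gt0 s (exprn_gt0 (4 * d.+2) n0)) (k2 / k1 ^+ 2) (N%:R `^ e).
by rewrite hN -NE ltNge key.
Qed.
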